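(* Let $N\ge1$, $0<s<1$, $1<p<2$ and $sp<1$. Let $u_0\ge0$ be locally integrable with $\int_{\mathbb R^N}u_0\varphi\,dx<\infty$ for some $\varphi\in\mathcal C(s,p)$. The solution of the Cauchy problem for $\partial_tu+\mathcal L_{s,p}u=0$ with initial data $u_0$ constructed by approximation from below is unique: if $0\le u_{0,n}\in L^1(\mathbb R^N)\cap L^\infty(\mathbb R^N)$ is any nondecreasing sequence converging monotonically to $u_0$ and $u_n$ are the semigroup solutions with data $u_{0,n}$, then the limit $u=\lim_n u_n$ does not depend on the choice of the sequence (it is called the minimal solution). In the class of minimal solutions the standard comparison result holds (if $u_0\le v_0$ are two such data, then the corresponding minimal solutions satisfy $u\le v$), and also the weighted $L^1$ estimate holds: for every $\varphi\in\mathcal C(s,p)$ and all times $t_1,t_2\ge 0$ at which $X(t)=\int_{\mathbb R^N}u(x,t)\varphi(x)\,dx$ is finite, $$|X(t_1)^{2-p}-X(t_2)^{2-p}|\le (2-p)\,C(\varphi)^{2-p}\,|t_1-t_2| .$$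
   Context: Let $\Phi_p(z)=|z|^{p-2}z$ and $\mathcal L_{s,p}(u)(x)=P.V.\int_{\mathbb R^N}\frac{\Phi_p(u(x)-u(y))}{|x-y|^{N+sp}}\,dy$. In $L^2(\mathbb R^N)$ it is the subdifferential of the convex functional $J(u)=\frac1{2p}\iint\frac{|u(x)-u(y)|^p}{|x-y|^{N+sp}}\,dxdy$; it generates a contraction semigroup $S_t$ which extends to an order-preserving contraction semigroup on every $L^q(\mathbb R^N)$, $1\le q<\infty$. A semigroup solution is $u(\cdot,t)=S_tu_0$ with $u_0\in L^q(\mathbb R^N)$ for some $1\le q<\infty$. For a function $\varphi$ on $\mathbb R^N$ put $(\mathcal M_{sp/2}\varphi)(x)=P.V.\int_{\mathbb R^N}\frac{|\varphi(x)-\varphi(y)|}{|x-y|^{N+sp}}\,dy$. The class $\mathcal C(s,p)$ consists of the smooth, strictly positive functions $\varphi$ on $\mathbb R^N$, with $\varphi(x)\to0$ as $|x|\to\infty$, such that $\mathcal M_{sp/2}\varphi$ is locally bounded and $$C(\varphi):=\int_{\mathbb R^N}\frac{|\mathcal M_{sp/2}\varphi(x)|^{1/(2-p)}}{\varphi(x)^{(p-1)/(2-p)}}\,dx<\infty .$$ *)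

(* Defs.v *)
From HB Require Import structures.
From mathcomp Require Import all_boot all_order all_algebra.
From mathcomp Require Import all_classical all_reals all_analysis.
From mathcomp Require Import measurable_realfun.

Set Implicit Arguments.
Unset Strict Implicit.
Unset Printing Implicit Defensive.
Import Order.TTheory GRing.Theory Num.Theory.
Import numFieldNormedType.Exports.

Local Open Scope classical_set_scope.
Local Open Scope ring_scope.

(* R^N is 'rV[R]_N with the product sigma-algebra, generated by the
   coordinates. Its library norm `|x| is the sup norm; the Euclidean one is
   enorm below. *)

Definition rV_display : measure_display.
Proof. exact: measure_tuple_display default_measure_display. Qed.

Section rV_measurable.
Context {R : realType} {n : nat}.

Let coord (i : 'I_n) (x : 'rV[R]_n) : measurableTypeR R := x ord0 i.

Let rV_set0 : g_sigma_preimage coord set0.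
Proof. exact: sigma_algebra0. Qed.

Let rV_setC A : g_sigma_preimage coord A -> g_sigma_preimage coord (~` A).
Proof. exact: sigma_algebraC. Qed.

Let rV_bigcup (F : _^nat) : (forall i, g_sigma_preimage coord (F i)) ->
  g_sigma_preimage coord (\bigcup_i (F i)).
Proof. exact: sigma_algebra_bigcup. Qed.

HB.instance Definition _ := @isMeasurable.Build rV_display
  'rV[R]_n (g_sigma_preimage coord) rV_set0 rV_setC rV_bigcup.

Lemma measurable_coord (i : 'I_n) :
  measurable_fun setT (fun x : 'rV[R]_n => x ord0 i : measurableTypeR R).
Proof.
move=> _ Y mY; rewrite setTI; apply: sub_sigma_algebra => /=.
rewrite -bigcup_seq/=; exists i => /=; first by rewrite mem_index_enum.
by exists Y => //; rewrite setTI.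
Qed.

Lemma measurable_fun_rV d (T : measurableType d) (f : T -> 'rV[R]_n) :
  (forall i, measurable_fun setT (fun x => f x ord0 i : measurableTypeR R)) ->
  measurable_fun setT f.
Proof.
move=> mf; apply: (@measurability _ _ _ _ _ _ (\big[setU/set0]_(i < n)
  preimage_set_system setT (coord i) measurable)) => //.
move=> _ [B + <-]; rewrite -bigcup_seq => -[i _ [A mA <-]].
by rewrite !setTI -comp_preimage -[X in measurable X]setTI; exact: mf.
Qed.

End rV_measurable.

Lemma sigma_finite_product d1 d2 (T1 : measurableType d1)
    (T2 : measurableType d2) (R : realType)
    (m1 : {sigma_finite_measure set T1 -> \bar R})
    (m2 : {sigma_finite_measure set T2 -> \bar R}) :
  sigma_finite setT (m1 \x m2)%E.
Proof.
have /sigma_finiteP[F [TF ndF Foo]] := sigma_finiteT m1.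
have /sigma_finiteP[G [TG ndG Goo]] := sigma_finiteT m2.
exists (fun n => F n `*` G n).
  rewrite -setXTT TF TG predeqE => -[x y]; split.
    move=> [/= [n _ Fnx] [k _ Gky]]; exists (maxn n k) => //; split.
    - by move: x Fnx; exact/subsetPset/ndF/leq_maxl.
    - by move: y Gky; exact/subsetPset/ndG/leq_maxr.
  by move=> [n _ []/= ? ?]; split; exists n.
move=> k; have [? ?] := Foo k; have [? ?] := Goo k.
split; first exact: measurableX.
by rewrite product_measure1E// lte_mul_pinfty// ge0_fin_numE.
Qed.

(* Lebesgue measure on R^n, by R^{n+1} = R x R^n. *)
Section lebesgue_rV.
Context {R : realType}.

Definition rV_cons n (z : measurableTypeR R * 'rV[R]_n) : 'rV[R]_n.+1 :=
  row_mx (\row__ z.1 : 'rV[R]_1) z.2.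

Lemma measurable_rV_cons n : measurable_fun setT (@rV_cons n).
Proof.
apply: measurable_fun_rV => i.
have [j ->|j ->] := split_ordP (i : 'I_(1 + n)).
  rewrite [X in measurable_fun _ X](_ : _ = fst)//.
  apply/funext => z; apply: etrans (row_mxEl _ _ _ _) _.
  by rewrite mxE.
rewrite [X in measurable_fun _ X](_ : _ =
    fun z : measurableTypeR R * 'rV[R]_n => z.2 ord0 j); last first.
  by apply/funext => z; exact: row_mxEr.
exact: (measurableT_comp (measurable_coord j) measurable_snd).
Qed.

Definition rV_uncons n (x : 'rV[R]_n.+1) : measurableTypeR R * 'rV[R]_n :=
  (x ord0 ord0, rsubmx (x : 'rV[R]_(1 + n))).

Lemma measurable_rV_uncons n : measurable_fun setT (@rV_uncons n).
Proof.
apply/measurable_fun_pairP; split; first exact: measurable_coord.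
apply: measurable_fun_rV => i.
rewrite [X in measurable_fun _ X](_ : _ = fun x : 'rV[R]_n.+1 =>
  x ord0 (rshift 1 i) : measurableTypeR R); last first.
  by apply/funext => x; rewrite /= mxE.
exact: measurable_coord.
Qed.

Lemma rV_consK n : cancel (@rV_cons n) (@rV_uncons n).
Proof.
move=> [a x]; rewrite /rV_uncons /rV_cons row_mxKr; congr pair.
have -> : ord0 = lshift n (@ord0 0) by exact/val_inj.
by apply: etrans (row_mxEl _ _ _ _) _; rewrite mxE.
Qed.

Section step.
Variables (n : nat) (m : {sigma_finite_measure set 'rV[R]_n -> \bar R}).

Definition lebesgue_rV_step : set 'rV[R]_n.+1 -> \bar R :=
  pushforward (lebesgue_measure \x m)%E (@rV_cons n).

Let mf := @measurable_rV_cons n.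

Let step0 : lebesgue_rV_step set0 = 0%E. Proof. exact: measure0. Qed.

Let step_ge0 A : (0 <= lebesgue_rV_step A)%E. Proof. exact: measure_ge0. Qed.

Let step_sigma_additive : semi_sigma_additive lebesgue_rV_step.
Proof. exact: measure_semi_sigma_additive. Qed.

HB.instance Definition _ := isMeasure.Build _ _ _ lebesgue_rV_step
  step0 step_ge0 step_sigma_additive.

Let step_sigma_finite : sigma_finite setT lebesgue_rV_step.
Proof.
have [F TF Ffin] := sigma_finite_product lebesgue_measure m.
exists (fun k => @rV_uncons n @^-1` F k).
  by rewrite -preimage_bigcup -TF preimage_setT.
move=> k; have [mFk Fk] := Ffin k; split.
  by rewrite -[X in measurable X]setTI; exact: measurable_rV_uncons.
rewrite /lebesgue_rV_step /pushforward -comp_preimage.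
by rewrite (_ : _ \o _ = id)//; apply/funext => z; exact: rV_consK.
Qed.

HB.instance Definition _ := Measure_isSigmaFinite.Build _ _ _ lebesgue_rV_step
  step_sigma_finite.

End step.

Fixpoint lebesgue_rV (n : nat) : {sigma_finite_measure set 'rV[R]_n -> \bar R} :=
  match n with
  | 0 => dirac (0 : 'rV[R]_0)
  | k.+1 => lebesgue_rV_step (lebesgue_rV k)
  end.

Definition enorm n (x : 'rV[R]_n) : R := Num.sqrt (\sum_i x ord0 i ^+ 2).

End lebesgue_rV.

Section definitions.
Context {R : realType} {N : nat}.
Local Notation E := 'rV[R]_N.
Local Notation mu := (@lebesgue_rV R N).
Implicit Types (s p t : R) (f g v phi : E -> R).

Local Open Scope ereal_scope.

Local Notation L1 := (Lfun mu 1).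
Local Notation L2 := (Lfun mu 2%:E).
Local Notation Loo := (Lfun mu +oo).

Definition L2norm f : \bar R := 'N[mu]_2%:E[EFin \o f].

(* The energy J; the integrand is 0 (= 0 / 0) on the diagonal. *)
Definition energy s p f : \bar R :=
  ((2 * p)^-1)%:E * \int[mu \x mu]_z
    (`|f z.1 - f z.2| `^ p / enorm (z.1 - z.2) `^ (N%:R + s * p))%:E.

(* xi belongs to the subdifferential of J at f in L^2(R^N); this is the L^2
   realisation of L_{s,p} f = xi. *)
Definition subdiff_energy s p f (xi : E -> R) : Prop :=
  [/\ f \in L2, energy s p f < +oo, xi \in L2 &
    forall v, v \in L2 ->
      energy s p f + \int[mu]_x (xi x * (v x - f x))%:E <= energy s p v].

(* The contraction semigroup on L^2(R^N) generated by -dJ: for each f in L^2,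
   t |-> S t f is the solution, continuous on [0, +oo[, of
   d^+u/dt + dJ(u) \ni 0 for t > 0 and u(0) = f. By Brezis' theorem on
   gradient flows of convex functionals it exists for all f in L^2, and it is
   unique by monotonicity of dJ. *)
Definition generated_semigroup s p (S : R -> (E -> R) -> E -> R) : Prop :=
  forall f, f \in L2 ->
  [/\ forall t, (0 <= t)%R -> S t f \in L2,
      {ae mu, forall x, S 0%R f x = f x},
      forall t, (0 <= t)%R ->
        L2norm (fun x => S r f x - S t f x)%R
          @[r --> within [set r | (0 <= r)%R] (nbhs t)] --> 0 &
      forall t, (0 < t)%R -> exists2 xi, subdiff_energy s p (S t f) xi &
        L2norm (fun x => h^-1 * (S (t + h)%R f x - S t f x) + xi x)%R
          @[h --> 0%R^'+] --> 0].

Definition basis_rV (i : 'I_N) : E := delta_mx ord0 i.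

Definition partial_derivs (l : seq 'I_N) phi : E -> R :=
  foldr (fun i g x => ('D_(basis_rV i) g x : R)%R) phi l.

Definition smooth_rV phi : Prop := forall l : seq 'I_N,
  continuous (partial_derivs l phi) /\
  forall x i, derivable (partial_derivs l phi) x (basis_rV i).

Definition vanishes_at_infinity phi : Prop :=
  forall e : R, (0 < e)%R -> exists M : R,
    forall x, (M < enorm x)%R -> (`|phi x| < e)%R.

(* M_{sp/2} phi; the principal value is the limit of the integrals over
   |x - y| > e. *)
Definition Mop s p phi (x : E) : \bar R :=
  lim (\int[mu]_(y in [set y | (e < enorm (x - y))%R])
    (`|phi x - phi y| / enorm (x - y) `^ (N%:R + s * p))%:E @[e --> 0%R^'+]).

Definition Cphi s p phi : \bar R :=
  \int[mu]_x (`|Mop s p phi x| `^ (2 - p)^-1 *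
    ((phi x `^ ((p - 1) / (2 - p)))^-1)%:E).

Definition class_C s p phi : Prop :=
  [/\ smooth_rV phi, forall x, (0 < phi x)%R, vanishes_at_infinity phi,
      forall x : E, exists K : R, \forall y \near x, `|Mop s p phi y| <= K%:E &
      Cphi s p phi < +oo].

Definition locally_integrable_rV f : Prop :=
  measurable_fun [set: E] f /\
  forall K : set E, compact K -> \int[mu]_(x in K) `|f x|%:E < +oo.

Definition initial_datum s p f : Prop :=
  [/\ locally_integrable_rV f, {ae mu, forall x, (0 <= f x)%R} &
    exists2 phi, class_C s p phi & \int[mu]_x (f x * phi x)%:E < +oo].

Definition approx_from_below (fn : nat -> E -> R) f : Prop :=
  [/\ forall n, [/\ fn n \in L1, fn n \in Loo &
        {ae mu, forall x, (0 <= fn n x)%R}],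
      forall n, {ae mu, forall x, (fn n x <= fn n.+1 x)%R} &
      {ae mu, forall x, fn n x @[n --> \oo] --> f x}].

(* u is the limit of the semigroup solutions with data fn n; it may a priori
   take the value +oo. *)
Definition limit_of_solutions (S : R -> (E -> R) -> E -> R)
    (fn : nat -> E -> R) (u : R -> E -> \bar R) : Prop :=
  forall t, (0 <= t)%R -> measurable_fun [set: E] (u t) /\
    {ae mu, forall x, (S t (fn n) x)%:E @[n --> \oo] --> u t x}.

Definition minimal_solution (S : R -> (E -> R) -> E -> R) f
    (u : R -> E -> \bar R) : Prop :=
  exists2 fn, approx_from_below fn f & limit_of_solutions S fn u.

Definition weighted_mass phi (w : E -> \bar R) : \bar R :=
  \int[mu]_x (w x * (phi x)%:E).

End definitions.

(* Main.v *)
Require Import Defs.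
From mathcomp Require Import all_boot all_order all_algebra.
From mathcomp Require Import ring lra.
From mathcomp Require Import all_classical all_reals all_analysis.
From mathcomp Require Import measurable_realfun ess_sup_inf.

(** For an initial datum f in L2 the curve S t f is the gradient flow of the
convex energy J, and everything about it comes from testing the subgradients
xi(t), with u'(t) = - xi(t), against well chosen functions.

Contraction and comparison. Let u and v be two flows, w = u - v, and let g be
nondecreasing and 1-Lipschitz with g(0) = 0.  Moving g(w) from u to v replaces
each pair of increments of u and v by two convex combinations of it, so
J(u - g(w)) + J(v + g(w)) <= J(u) + J(v) (energy_exchange), and hence the
subgradients xi of u and eta of v satisfy <xi - eta, g(w)> >= 0
(subdiff_monotone).  If G is the primitive of g, the integral of G(w(t)) is
therefore nonincreasing.  For g(r) = min(r^+, e), G / e increases to r^+ as e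
tends to 0, which gives the T-contraction in L1 (flow_L1_contraction): the
integral of (u(t) - v(t))^+ does not increase.  If f_m increases to u0 and g_n
increases to v0 >= u0, then (f_m - g_n)^+ tends to 0 in L1 by dominated
convergence, since g_n >= 0 makes f_m a bound; the contraction turns this into
S t f_m <= sup_n S t g_n a.e. (solution_le_sup).  Used for u0 = v0, and then
for u0 <= v0, this one inequality gives the independence of the approximating
sequence and the comparison principle.

The weighted estimate. Expanding J(u + h psi) to first order in h bounds
<xi, psi> by half of the double integral of
|u(x) - u(y)|^(p-1) |psi(x) - psi(y)| / |x - y|^(N + sp) (weak_bound).  As
|a - b|^(p-1) <= |a|^(p-1) + |b|^(p-1), this is at most the integral of
|u|^(p-1) M phi for every psi whose increments are dominated by those of phi,
and Hoelder's inequality with exponents 1/(p-1) and 1/(2-p) bounds the latter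
by X^(p-1) C(phi)^(2-p), X being the integral of |u| phi (jump_pairing_le).
The weight phi itself may lie outside L2; the functions psi = (phi - 1/k)^+
have bounded support and finite energy, their increments are dominated by those
of phi, and they increase to phi.  So |X'| <= C(phi)^(2-p) X^(p-1) in
integrated form (mass_growth); X is bounded because the L1 norm of u(t) does
not increase, and integrating the differential inequality for X^(2-p) gives the
estimate (powR_lipschitz_of_ode).  It passes to the minimal solution by
dominated convergence (minimal_mass_cvg). *)

Set Implicit Arguments.
Unset Strict Implicit.
Unset Printing Implicit Defensive.
Import Order.TTheory GRing.Theory Num.Theory.
Import numFieldNormedType.Exports.
Local Open Scope classical_set_scope.
Local Open Scope ring_scope.

(** * Inequalities between powers, and growth from one-sided derivatives *)

Section powers.
Context {R : realType}.
Implicit Types a b p q r : R.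

Lemma powR_young a b p q : 0 <= a -> 0 <= b -> 0 < q -> 0 < p -> p + q = 1 ->
  a `^ p * b `^ q <= p * a + q * b.
Proof.
move=> a0 b0 q0 p0 pq.
have := @conjugate_powR R (a `^ p) (b `^ q) p^-1 q^-1 (powR_ge0 _ _) (powR_ge0 _ _).
rewrite !invr_gt0 !invrK -!powRrM => /(_ p0 q0 pq).
by rewrite !mulfV ?gt_eqF// !powRr1// (mulrC a) (mulrC b).
Qed.

(** The graph of the concave power lies below its tangent at b; this is Young's
inequality for a^q b^(1-q) divided by b^(1-q). *)
Lemma powR_concave_tangent a b q : 0 <= a -> 0 < b -> 0 < q < 1 ->
  a `^ q - b `^ q <= q * b `^ (q - 1) * (a - b).
Proof.
move=> a0 b0 /andP[q0 q1].
have q1' : 0 < 1 - q by rewrite subr_gt0.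
have := powR_young a0 (ltW b0) q1' q0 (subrKC q 1).
have bq : b `^ q * b `^ (1 - q) = b.
  by rewrite -powRD ?subrKC ?powRr1 ?ltW//; apply/implyP => _; rewrite gt_eqF.
have bi : b `^ (q - 1) * b `^ (1 - q) = 1.
  rewrite -powRD; last by apply/implyP => _; rewrite gt_eqF.
  by rewrite addrC addrA subrK subrr powRr0.
have c0 : 0 < b `^ (1 - q) by rewrite powR_gt0.
move=> H; rewrite -(ler_pM2r c0) mulrBl bq.
have -> : q * b `^ (q - 1) * (a - b) * b `^ (1 - q) =
  q * (a - b) * (b `^ (q - 1) * b `^ (1 - q)) by ring.
by rewrite bi; lra.
Qed.

(** The tangent of the convex power at b lies below its graph; again Young's
inequality, for a b^(p-1). *)
Lemma powR_convex_tangent a b p : 0 <= a -> 0 <= b -> 1 < p ->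
  b `^ p <= a `^ p + p * b `^ (p - 1) * (b - a).
Proof.
move=> a0 b0 p1; have p0 : 0 < p by rewrite (lt_trans _ p1).
have q0 : 0 < 1 - p^-1 by rewrite subr_gt0 invf_lt1.
have ip0 : 0 < p^-1 by rewrite invr_gt0.
have H := powR_young (powR_ge0 a p) (powR_ge0 b p) q0 ip0 (subrKC _ _).
rewrite -!powRrM mulfV ?gt_eqF// powRr1// mulrBr mulr1 mulfV ?gt_eqF// in H.
have H1 : p * (a * b `^ (p - 1)) <= a `^ p + (p - 1) * b `^ p.
  have -> : a `^ p + (p - 1) * b `^ p = p * (p^-1 * a `^ p + (1 - p^-1) * b `^ p).
    by field; rewrite gt_eqF.
  by rewrite ler_pM2l.
have := mulr_powRB1 b0 p0 => bp.
have -> : p * b `^ (p - 1) * (b - a) =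
  p * (b * b `^ (p - 1)) - p * (a * b `^ (p - 1)) by ring.
by rewrite bp; lra.
Qed.

Lemma powR_subadd a b q : 0 <= a -> 0 <= b -> 0 < q -> q <= 1 ->
  (a + b) `^ q <= a `^ q + b `^ q.
Proof.
move=> a0 b0 q0 q1.
have [->|ab] := eqVneq (a + b) 0.
  by rewrite powR0 ?gt_eqF// addr_ge0 ?powR_ge0.
have c0 : 0 < a + b by rewrite lt0r ab addr_ge0.
have aux x y : 0 <= x -> 0 < y -> x <= y -> x / y * y `^ q <= x `^ q.
  move=> x0 y0 xy; have [->|xn0] := eqVneq x 0.
    by rewrite !mul0r powR_ge0.
  have {xn0}x0 : 0 < x by rewrite lt0r xn0.
  have -> : x `^ q = (x / y) `^ q * y `^ q.
    rewrite -powRM ?divr_ge0 ?ltW// divfK// gt_eqF//.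
  rewrite ler_wpM2r ?powR_ge0// ger1_powR// divr_gt0//= ler_pdivrMr// mul1r//.
have ac : a <= a + b by rewrite lerDl.
have bc : b <= a + b by rewrite lerDr.
have := lerD (aux _ _ a0 c0 ac) (aux _ _ b0 c0 bc).
by rewrite -mulrDl -mulrDl divff// mul1r.
Qed.

Lemma powR_close a b e q : 0 <= a -> 0 <= b -> 0 < e -> 0 < q -> q <= 1 ->
  `|a - b| <= e `^ q^-1 -> `|a `^ q - b `^ q| <= e.
Proof.
move=> a0 b0 e0 q0 q1 ab.
have eq : (e `^ q^-1) `^ q = e by rewrite -powRrM mulVf ?gt_eqF// powRr1// ltW.
have one x y : 0 <= x -> 0 <= y -> x - y <= e `^ q^-1 -> x `^ q - y `^ q <= e.
  move=> x0 y0 xy.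
  have := powR_subadd y0 (powR_ge0 e q^-1) q0 q1; rewrite eq.
  suff : x `^ q <= (y + e `^ q^-1) `^ q by lra.
  by rewrite ge0_ler_powR ?nnegrE ?(ltW q0) ?addr_ge0 ?powR_ge0//; lra.
move: ab; rewrite ler_norml => /andP[ab ba].
have := one a b a0 b0 ba; have := one b a b0 a0 ltac:(lra).
by rewrite ler_norml => ? ?; apply/andP; split; lra.
Qed.

(** Both arguments on the left are convex combinations of A and B with exchanged
weights, so convexity of the power bounds the sum. *)
Lemma norm_powR_exchange (A B th p : R) : 1 <= p -> 0 <= th <= 1 ->
  `|A - th * (A - B)| `^ p + `|B + th * (A - B)| `^ p <= `|A| `^ p + `|B| `^ p.
Proof.
move=> p1 /andP[t0 t1].
have p0 : 0 <= p by rewrite (le_trans _ p1).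
have aux (t x y : R) (u0 : 0 <= t) (u1 : t <= 1) :
    `|t * x + (1 - t) * y| `^ p <= t * `|x| `^ p + (1 - t) * `|y| `^ p.
  apply: (@le_trans _ _ ((t * `|x| + (1 - t) * `|y|) `^ p)).
    rewrite ge0_ler_powR ?nnegrE// ?addr_ge0 ?mulr_ge0 ?subr_ge0//.
    rewrite (le_trans (ler_normD _ _))// !normrM (ger0_norm u0).
    by rewrite (ger0_norm (_ : 0 <= 1 - t)) ?subr_ge0.
  have := @convex_powR R p p1 (@Itv01 R t u0 u1) `|x| `|y|.
  rewrite !inE/= !in_itv/= !andbT => /(_ (normr_ge0 _) (normr_ge0 _)).
  by rewrite !convRE.
have t1' : 0 <= 1 - th by rewrite subr_ge0.
have t0' : 1 - th <= 1 by rewrite gerBl.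
have H1 := aux (1 - th) A B t1' t0'.
have H2 := aux th A B t0 t1.
have E1 : A - th * (A - B) = (1 - th) * A + (1 - (1 - th)) * B by ring.
have E2 : B + th * (A - B) = th * A + (1 - th) * B by ring.
rewrite E1 E2; lra.
Qed.

(** First-order expansion with a remainder of order h^p: the derivative
p |a + h d|^(p-1) is split by subadditivity of the power p - 1 <= 1.  The
remainder is o(h) because p > 1. *)
Lemma norm_powR_perturb (a d h p : R) : 0 < h -> 1 < p < 2 ->
  `|a + h * d| `^ p <=
  `|a| `^ p + p * h * (`|a| `^ (p - 1) * `|d|) + p * (h `^ p * `|d| `^ p).
Proof.
move=> h0 /andP[p1 p2].
have p0 : 0 < p by rewrite (lt_trans _ p1).
have q0 : 0 < p - 1 by rewrite subr_gt0.
have q1 : p - 1 <= 1 by lra.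
have T := powR_convex_tangent (normr_ge0 a) (normr_ge0 (a + h * d)) p1.
have D : `|a + h * d| - `|a| <= h * `|d|.
  by have := ler_normD a (h * d); rewrite normrM (gtr0_norm h0); lra.
have P : `|a + h * d| `^ (p - 1) <= `|a| `^ (p - 1) + h `^ (p - 1) * `|d| `^ (p - 1).
  apply: (@le_trans _ _ ((`|a| + h * `|d|) `^ (p - 1))); last first.
    apply: le_trans (powR_subadd _ _ q0 q1) _ => //; first by rewrite mulr_ge0// ltW.
    by rewrite powRM// ltW.
  apply: ge0_ler_powR (ltW q0) _ _ _ _ _; rewrite ?nnegrE//; last by lra.
  by rewrite addr_ge0// mulr_ge0// ltW.
have hp : h * h `^ (p - 1) = h `^ p by rewrite mulr_powRB1// ltW.
have dp : `|d| * `|d| `^ (p - 1) = `|d| `^ p by rewrite mulr_powRB1.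
apply: le_trans T _; rewrite -!addrA lerD2l.
apply: (@le_trans _ _ (p * (`|a| `^ (p - 1) + h `^ (p - 1) * `|d| `^ (p - 1)) * (h * `|d|))).
  apply: (@le_trans _ _ (p * `|a + h * d| `^ (p - 1) * (h * `|d|))).
    by rewrite ler_wpM2l// mulr_ge0 ?powR_ge0 ?(ltW p0).
  by rewrite ler_wpM2r ?mulr_ge0 ?(ltW h0)// ler_wpM2l// ltW.
by rewrite -hp -dp le_eqVlt; apply/orP; left; apply/eqP; ring.
Qed.

End powers.

Section growth.
Context {R : realType}.

(** The set of points reached from x with slope at most c + e is closed, and its
supremum cannot be smaller than b, because the one-sided bound allows one more
step to the right.  The bound is only required at interior points: a gradient
flow has a right derivative at positive times, and mere continuity at 0. *)
Lemma dini_growth (F : R -> R) (c a b : R) :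
  (forall t e : R, a <= t <= b -> 0 < e -> exists2 d, 0 < d &
    forall r : R, a <= r <= b -> `|r - t| < d -> `|F r - F t| < e) ->
  (forall t e : R, a < t < b -> 0 < e -> exists2 d, 0 < d &
    forall h : R, 0 < h < d -> F (t + h) <= F t + (c + e) * h) ->
  a <= b -> F b - F a <= c * (b - a).
Proof.
move=> Fc Fd ab.
have pos (e x : R) : 0 < e -> a < x -> x <= b ->
    F b - F x <= (c + e) * (b - x).
  move=> e0 ax xb.
  pose P := [set y | x <= y <= b /\ F y <= F x + (c + e) * (y - x)].
  have Px : P x by split; [rewrite lexx xb|rewrite subrr mulr0 addr0].
  have hsP : has_sup P.
    by split; [exists x|exists b => y [/andP[]]].
  set m := sup P.
  have xm : x <= m by apply: ub_le_sup => //; exact: (proj2 hsP).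
  have mb : m <= b by apply: ge_sup; [exists x|move=> y [/andP[]]].
  have am : a < m by exact: lt_le_trans xm.
  have amb : a <= m <= b by rewrite (ltW am) mb.
  have Pm : P m.
    split; first by rewrite xm mb.
    apply/ler_addgt0Pr => k k0.
    pose K := `|c + e| + 1.
    have K0 : 0 < K by rewrite ltr_wpDl.
    have [d d0 dP] := Fc m (k / 2) amb ltac:(lra).
    have dk0 : 0 < Num.min d (k / 2 / K) by rewrite lt_min d0 !divr_gt0.
    have [y Py my] := sup_adherent dk0 hsP.
    have [/andP[xy yb] Fy] := Py.
    have ym : y <= m by apply: ub_le_sup => //; exact: (proj2 hsP).
    rewrite -/m in my.
    have ayb : a <= y <= b by rewrite yb (le_trans (ltW ax) xy).
    have := dP y ayb.
    rewrite ler0_norm; last by rewrite subr_le0.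
    have [yd yk] : m - y < d /\ m - y < k / 2 / K.
      by split; rewrite ltrBlDr addrC -ltrBlDr; apply: le_lt_trans my;
        rewrite lerD2l lerN2 ge_min lexx ?orbT.
    rewrite opprB => /(_ yd); rewrite ltr_norml => /andP[F1 _].
    rewrite ltr_pdivlMr// in yk.
    have : - ((c + e) * (m - y)) <= (m - y) * K.
      rewrite mulrC -mulrN ler_wpM2l ?subr_ge0// /K.
      by apply: le_trans (ler_norm _) _; rewrite normrN; lra.
    have : (c + e) * (m - x) = (c + e) * (m - y) + (c + e) * (y - x) by ring.
    by move=> ->; lra.
  have [<-|mnb] := eqVneq m b.
    by case: Pm => _; lra.
  have mltb : m < b by rewrite lt_neqAle mnb mb.
  have [d d0 dP] := Fd m e ltac:(by rewrite am mltb) e0.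
  pose h := Num.min (d / 2) (b - m).
  have h0 : 0 < h by rewrite lt_min subr_gt0 mltb divr_gt0.
  have hd : h < d by rewrite gt_min; apply/orP; left; lra.
  have hb : h <= b - m by rewrite ge_min lexx orbT.
  have : P (m + h).
    split; first by apply/andP; split; lra.
    case: Pm => _ Fm; have := dP h; rewrite h0 hd => /(_ isT).
    have -> : (c + e) * (m + h - x) = (c + e) * (m - x) + (c + e) * h by ring.
    by lra.
  move/(ub_le_sup (proj2 hsP)); rewrite -/m; lra.
have pos' (x : R) : a < x -> x <= b -> F b - F x <= c * (b - x).
  move=> ax xb; apply/ler_addgt0Pr => k k0.
  have k' : 0 < k / (b - x + 1) by rewrite divr_gt0//; lra.
  apply: le_trans (pos _ _ k' ax xb) _.
  rewrite mulrDl lerD2l mulrAC ler_pdivrMr; last by lra.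
  by rewrite ler_wpM2l ?(ltW k0)//; lra.
move: ab; rewrite le_eqVlt => /predU1P[<-|ab]; first by rewrite !subrr mulr0.
apply/ler_addgt0Pr => k k0.
have [d d0 dP] := Fc a (k / 2) ltac:(by rewrite lexx ltW) ltac:(lra).
pose K := `|c| + 1.
have K0 : 0 < K by rewrite ltr_wpDl.
pose x := Num.min (Num.min (d / 2) (b - a)) (k / 2 / K).
have x0 : 0 < x by rewrite !lt_min subr_gt0 ab !divr_gt0.
have xd : x < d by rewrite /x !gt_min; apply/orP; left; apply/orP; left; lra.
have xb : x <= b - a by rewrite /x !ge_min lexx orbT.
have xk : x * K <= k / 2 by rewrite -ler_pdivlMr// /x ge_min lexx orbT.
have axb : a <= a + x <= b by apply/andP; split; lra.
have := dP _ axb; rewrite addrAC subrr add0r gtr0_norm// => /(_ xd).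
rewrite ltr_norml => /andP[_ F2].
have := pos' (a + x) ltac:(lra) ltac:(lra).
have : - (c * x) <= x * K.
  rewrite mulrC -mulrN ler_wpM2l ?(ltW x0)// /K.
  by apply: le_trans (ler_norm _) _; rewrite normrN; lra.
have -> : c * (b - (a + x)) = c * (b - a) - c * x by ring.
by lra.
Qed.

(** Cut the segment into n equal parts: the quadratic terms add up to O(1/n). *)
Lemma lipschitz_of_quadratic_defect (Z : R -> R) (c K : R) :
  (forall a b : R, 0 <= a -> 0 <= b ->
    Z b - Z a <= c * `|b - a| + K * `|b - a| ^+ 2) ->
  forall a b : R, 0 <= a -> 0 <= b -> Z b - Z a <= c * `|b - a|.
Proof.
move=> H a b a0 b0; apply/ler_addgt0Pr => k k0.
pose L := `|b - a|.
(* enough parts for the total defect K L^2 / n to be at most k *)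
pose n := (Num.trunc (`|K| * L ^+ 2 / k)).+1.
have n0 : 0 < n%:R :> R by rewrite ltr0n.
have nK : `|K| * L ^+ 2 / k < n%:R by rewrite truncnS_gt.
pose x i := a + i%:R / n%:R * (b - a).
have x_ge0 (i : nat) : (i <= n)%N -> 0 <= x i.
  move=> iN; have i1 : i%:R / n%:R <= 1 :> R by rewrite ler_pdivrMr// mul1r ler_nat.
  have i0 : 0 <= i%:R / n%:R :> R by rewrite divr_ge0.
  have -> : x i = (1 - i%:R / n%:R) * a + i%:R / n%:R * b by rewrite /x; ring.
  by rewrite addr_ge0// mulr_ge0// subr_ge0.
have step (i : nat) : (i <= n)%N ->
    Z (x i) - Z a <= i%:R * (c * (L / n%:R) + K * (L / n%:R) ^+ 2).
  elim: i => [|i IH] iN.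
    by rewrite /x mul0r mul0r addr0 subrr mul0r.
  have := H _ _ (x_ge0 _ (ltnW iN)) (x_ge0 _ iN).
  have -> : `|x i.+1 - x i| = L / n%:R.
    rewrite /L -[n%:R in RHS]gtr0_norm// -normfV -normrM; congr `|_|.
    by rewrite /x -[i.+1]addn1 natrD; ring.
  have := IH (ltnW iN); rewrite -[i.+1]addn1 natrD mulrDl mul1r addn1.
  by lra.
have := step n (leqnn n).
have -> : x n = b by rewrite /x divff ?gt_eqF// mul1r subrKC.
move=> /le_trans; apply.
have -> : n%:R * (c * (L / n%:R) + K * (L / n%:R) ^+ 2) = c * L + K * L ^+ 2 / n%:R.
  by field; rewrite gt_eqF.
rewrite lerD2l ler_pdivrMr//.
move: nK; rewrite ltr_pdivrMr// (mulrC k) => nK.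
apply: le_trans (ltW nK).
by rewrite ler_wpM2r ?sqr_ge0// ler_norm.
Qed.

(** An integrated form of |X'| <= D X^(p-1) implies that X^(2-p) is Lipschitz
with constant (2-p) D.  Working with (X + e)^(2-p) and letting e tend to 0
avoids the points where X vanishes. *)
Lemma powR_lipschitz_of_ode (X : R -> R) (p D B : R) : 1 < p < 2 -> 0 <= D ->
  (forall t : R, 0 <= t -> 0 <= X t <= B) ->
  (forall a b M : R, 0 <= a -> a <= b -> 0 <= M ->
     (forall t : R, a <= t <= b -> X t <= M) ->
     `|X b - X a| <= D * M `^ (p - 1) * (b - a)) ->
  forall a b : R, 0 <= a -> 0 <= b ->
    `|X a `^ (2 - p) - X b `^ (2 - p)| <= (2 - p) * D * `|a - b|.
Proof.
move=> /andP[p1 p2] D0 XB H.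
set q := 2 - p; have q0 : 0 < q by rewrite subr_gt0.
have q1 : q < 1 by rewrite /q; lra.
have B0 : 0 <= B by have /andP[] := XB 0 (lexx 0); exact: le_trans.
pose L := D * B `^ (p - 1).
have L0 : 0 <= L by rewrite mulr_ge0 ?powR_ge0.
have lip (a b : R) : 0 <= a -> 0 <= b -> `|X b - X a| <= L * `|b - a|.
  wlog ab : a b / a <= b => [W a0 b0|a0 b0].
    have [/W|/ltW /W] := leP a b; first exact.
    by rewrite distrC [in X in _ -> X](distrC b a); exact.
  rewrite [`|b - a|]ger0_norm ?subr_ge0//; apply: H => // t /andP[ta _].
  by have /andP[] := XB _ (le_trans a0 ta).
(* X varies by at most L |b - a| between a and b, so M = X a + L |b - a| is
   admissible on either side of a *)
have loc (a b : R) : 0 <= a -> 0 <= b ->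
    `|X b - X a| <= D * (X a + L * `|b - a|) `^ (p - 1) * `|b - a|.
  move=> a0 b0.
  have gen (x y z : R) : 0 <= x -> x <= y -> 0 <= z -> (z == x) || (z == y) ->
      `|X y - X x| <= D * (X z + L * `|y - x|) `^ (p - 1) * `|y - x|.
    move=> x0 xy z0 zxy; rewrite [X in _ * X]ger0_norm ?subr_ge0//.
    have /andP[Xz _] := XB _ z0.
    have M0 : 0 <= X z + L * `|y - x| by rewrite addr_ge0// mulr_ge0.
    apply: (H _ _ _ x0 xy M0).
    move=> t /andP[xt ty]; have t0 := le_trans x0 xt.
    have := lip z t z0 t0; rewrite ler_norml => /andP[_ T].
    rewrite -lerBlDl; apply: (le_trans T).
    rewrite ler_wpM2l// (ger0_norm (_ : 0 <= y - x)) ?subr_ge0//.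
    by rewrite ler_norml; case/orP: zxy => /eqP ->; apply/andP; split; lra.
  have [ab|/ltW ba] := leP a b; first by apply: gen => //; rewrite eqxx.
  rewrite [`|X b - _|]distrC [in `|b - a|]distrC.
  by apply: gen => //; rewrite eqxx orbT.
have powD (r x y : R) : 0 < r -> 0 < x -> x `^ (r - 1) * x `^ (1 - r) = 1.
  move=> _ x0; rewrite -powRD; last by apply/implyP => _; rewrite gt_eqF.
  by rewrite addrC addrA subrK subrr powRr0.
have key (e : R) : 0 < e -> forall a b : R, 0 <= a -> 0 <= b ->
    (X b + e) `^ q - (X a + e) `^ q <= q * D * `|b - a|.
  move=> e0.
  apply: (@lipschitz_of_quadratic_defect (fun t => (X t + e) `^ q) _
    (q * D * (L / e))) => a b a0 b0.
  have /andP[Xa _] := XB _ a0; have /andP[Xb _] := XB _ b0.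
  set h := `|b - a|; have h0 : 0 <= h by exact: normr_ge0.
  pose y := X a + e; have y0 : 0 < y by rewrite ltr_wpDl.
  have ye : e <= y by rewrite lerDr.
  apply: le_trans (powR_concave_tangent (_ : 0 <= X b + e) y0 _) _.
  - by rewrite addr_ge0// ltW.
  - by rewrite q0 q1.
  have -> : X b + e - y = X b - X a by rewrite /y; ring.
  have c0 : 0 <= q * y `^ (q - 1) by rewrite mulr_ge0 ?powR_ge0// ltW.
  apply: (@le_trans _ _ (q * y `^ (q - 1) * `|X b - X a|)).
    by rewrite ler_wpM2l// ler_norm.
  apply: le_trans (ler_wpM2l c0 (loc a b a0 b0)) _; rewrite -/h.
  have hp : (X a + L * h) `^ (p - 1) <= y `^ (p - 1) * (1 + L * h / y).
    have -> : p - 1 = 1 - q by rewrite /q; ring.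
    have z1 : 1 <= 1 + L * h / y.
      have Lh : 0 <= L * h by exact: mulr_ge0.
      have : 0 <= L * h / y by exact: divr_ge0 Lh (ltW y0).
      by lra.
    apply: (@le_trans _ _ ((y * (1 + L * h / y)) `^ (1 - q))).
      apply: ge0_ler_powR; rewrite ?nnegrE ?subr_ge0 ?(ltW q1)//.
      - by rewrite addr_ge0// mulr_ge0.
      - by rewrite mulr_ge0 ?(ltW y0)// (le_trans _ z1).
      rewrite mulrDr mulr1 mulrCA divff ?mulr1 ?gt_eqF// lerD2r /y lerDl ltW//.
    rewrite powRM ?(ltW y0)//; last by rewrite (le_trans _ z1).
    rewrite ler_wpM2l ?powR_ge0// ler1_powR//.
    by rewrite gerBl ltW.
  apply: (@le_trans _ _ (q * y `^ (q - 1) * (D * (y `^ (p - 1) * (1 + L * h / y)) * h))).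
    by rewrite ler_wpM2l// ler_wpM2r// ler_wpM2l.
  have yy : y `^ (q - 1) * y `^ (p - 1) = 1.
    have -> : p - 1 = 1 - q by rewrite /q; ring.
    exact: powD.
  have -> : q * y `^ (q - 1) * (D * (y `^ (p - 1) * (1 + L * h / y)) * h) =
    (y `^ (q - 1) * y `^ (p - 1)) * (q * D * h + q * D * (L / y) * h ^+ 2) by ring.
  rewrite yy mul1r lerD2l ler_wpM2r ?sqr_ge0// ler_wpM2l ?mulr_ge0 ?(ltW q0)//.
  by rewrite ler_wpM2l// lef_pV2.
have one (a b : R) : 0 <= a -> 0 <= b -> X b `^ q - X a `^ q <= q * D * `|b - a|.
  move=> a0 b0; apply/ler_addgt0Pr => k k0.
  have /andP[Xa _] := XB _ a0; have /andP[Xb _] := XB _ b0.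
  (* the shift changes the q-th power by at most e^q = k *)
  pose e := k `^ q^-1.
  have e0 : 0 < e by exact: powR_gt0.
  have eq : e `^ q = k by rewrite /e -powRrM mulVf ?gt_eqF// powRr1// ltW.
  have := key e e0 a b a0 b0.
  have := powR_subadd Xa (ltW e0) q0 (ltW q1); rewrite eq.
  have : X b `^ q <= (X b + e) `^ q.
    rewrite ge0_ler_powR ?nnegrE ?(ltW q0) ?addr_ge0 ?(ltW e0)//.
    by rewrite lerDl ltW.
  by lra.
move=> a b a0 b0; rewrite ler_norml; apply/andP; split; last exact: one.
by rewrite lerNl opprB [`|a - b|]distrC; exact: one.
Qed.

End growth.

(** * The Hilbert space L2 and differentiable curves in it *)

Section L2.
Context d (T : measurableType d) (R : realType).
Variable mu : {measure set T -> \bar R}.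
Implicit Types f g : T -> R.
Local Notation L2 := (Lfun mu 2%:E).

Definition ip f g : R := \int[mu]_x (f x * g x).
Definition nrm f : R := fine ('N[mu]_2%:E[EFin \o f])%E.

Lemma L2_measurable f : f \in L2 -> measurable_fun setT f.
Proof. by rewrite inE => /andP[/[!inE]]. Qed.

Lemma L2_nrm f : f \in L2 -> (nrm f)%:E = ('N[mu]_2%:E[EFin \o f])%E.
Proof.
rewrite inE => /andP[_ /[!inE] h]; rewrite /nrm fineK//.
by rewrite fin_numElt (lt_le_trans ltNy0) ?Lnorm_ge0.
Qed.

Lemma sqr_Lnorm2 f : ('N[mu]_2%:E[EFin \o f] `^ 2 = \int[mu]_x (f x ^+ 2)%:E)%E.
Proof.
rewrite poweR_Lnorm ?pnatr_eq0//; apply: eq_integral => x _ /=.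
by rewrite powR_mulrn// -normrX ger0_norm// sqr_ge0.
Qed.

Lemma L2P f : measurable_fun setT f -> (\int[mu]_x (f x ^+ 2)%:E < +oo)%E ->
  f \in L2.
Proof.
move=> mf foo; rewrite inE; apply/andP; split; rewrite inE//=.
apply: (@lty_poweRy _ _ 2); first by rewrite pnatr_eq0.
by rewrite sqr_Lnorm2.
Qed.

Lemma L2_sqr f : f \in L2 -> (\int[mu]_x (f x ^+ 2)%:E = (nrm f ^+ 2)%:E)%E.
Proof.
move=> f2; rewrite -sqr_Lnorm2 -L2_nrm// poweR_EFin powR_mulrn//.
by rewrite fine_ge0// Lnorm_ge0.
Qed.

Lemma nrm_ge0 f : 0 <= nrm f. Proof. by rewrite fine_ge0// Lnorm_ge0. Qed.

Lemma nrm_sqr f : f \in L2 -> nrm f ^+ 2 = ip f f.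
Proof. by move=> /L2_sqr f2; rewrite /ip /Rintegral -[LHS]/(fine _%:E) -f2. Qed.

Lemma L2_dom f g : measurable_fun setT g -> f \in L2 ->
  (forall x, `|g x| <= `|f x|) -> g \in L2 /\ nrm g <= nrm f.
Proof.
move=> mg f2 gf.
have mf := L2_measurable f2.
have le2 : (\int[mu]_x (g x ^+ 2)%:E <= \int[mu]_x (f x ^+ 2)%:E)%E.
  apply: ge0_le_integral => //=.
  - by move=> x _; rewrite lee_fin sqr_ge0.
  - by apply/measurable_EFinP; exact: measurable_funX.
  - by apply/measurable_EFinP; exact: measurable_funX.
  - by move=> x _; rewrite lee_fin -[g x ^+ 2]real_normK ?num_real//
      -[f x ^+ 2]real_normK ?num_real// lerXn2r ?nnegrE.
have g2 : g \in L2 by apply: L2P => //; rewrite (le_lt_trans le2)// L2_sqr// ltry.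
split => //; move: le2; rewrite !L2_sqr// lee_fin.
by rewrite ler_pXn2r ?nnegrE ?nrm_ge0.
Qed.

Lemma L2D f g : f \in L2 -> g \in L2 -> (fun x => f x + g x) \in L2.
Proof.
move=> f2 g2; have le12 : (1 <= 2%:E :> \bar R)%E by rewrite lee_fin ler1n.
by have [_ H] := Lfun_addr_closed mu le12; exact: (H f g f2 g2).
Qed.

Lemma L2Z f a : f \in L2 -> (fun x => a * f x) \in L2.
Proof.
move=> f2; rewrite (_ : (fun x => _) = a \o* f).
  by apply: Lfun_scale => //; rewrite ler1n.
by apply/funext => x; rewrite /= mulrC.
Qed.

Lemma L2Zr f a : f \in L2 -> (fun x => f x * a) \in L2.
Proof.
move=> f2; rewrite (_ : (fun x => _) = fun x => a * f x); first exact: L2Z.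
by apply/funext => x; rewrite mulrC.
Qed.

Lemma L2N f : f \in L2 -> (fun x => - f x) \in L2.
Proof.
move=> f2; rewrite (_ : (fun x => _) = fun x => -1 * f x); first exact: L2Z.
by apply/funext => x; rewrite mulN1r.
Qed.

Lemma L2B f g : f \in L2 -> g \in L2 -> (fun x => f x - g x) \in L2.
Proof. by move=> f2 /L2N; exact: L2D. Qed.

Lemma ip_integrable f g : f \in L2 -> g \in L2 ->
  mu.-integrable setT (EFin \o (fun x => f x * g x)).
Proof. by move=> f2 g2; apply/Lfun1_integrable; exact: Lfun2_mul_Lfun1. Qed.

Lemma ip_EFin f g : f \in L2 -> g \in L2 ->
  (\int[mu]_x (f x * g x)%:E = (ip f g)%:E)%E.
Proof.
by move=> f2 g2; rewrite /ip /Rintegral fineK// integrable_fin_num// ip_integrable.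
Qed.

Lemma ipC f g : ip f g = ip g f.
Proof. by apply: eq_Rintegral => x _; rewrite mulrC. Qed.

Lemma ipDr f g h : f \in L2 -> g \in L2 -> h \in L2 ->
  ip f (fun x => g x + h x) = ip f g + ip f h.
Proof.
move=> f2 g2 h2; rewrite /ip -RintegralD//; try exact: ip_integrable.
by apply: eq_Rintegral => x _; rewrite mulrDr.
Qed.

Lemma ipZr f g a : f \in L2 -> g \in L2 -> ip f (fun x => a * g x) = a * ip f g.
Proof.
move=> f2 g2; rewrite /ip -RintegralZl//; last exact: ip_integrable.
by apply: eq_Rintegral => x _; rewrite mulrCA.
Qed.

Lemma ipNr f g : f \in L2 -> g \in L2 -> ip f (fun x => - g x) = - ip f g.
Proof.
move=> f2 g2; rewrite -mulN1r -ipZr//.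
by apply: eq_Rintegral => x _; rewrite mulN1r.
Qed.

Lemma ipBr f g h : f \in L2 -> g \in L2 -> h \in L2 ->
  ip f (fun x => g x - h x) = ip f g - ip f h.
Proof. by move=> f2 g2 h2; rewrite ipDr ?ipNr//; exact: L2N. Qed.

Lemma ip_le f g : f \in L2 -> g \in L2 -> `|ip f g| <= nrm f * nrm g.
Proof.
move=> f2 g2.
apply: (le_trans (le_normr_Rintegral measurableT (ip_integrable f2 g2))).
rewrite -lee_fin EFinM !L2_nrm//.
rewrite [X in (X <= _)%E](_ : _ = 'N[mu]_1[EFin \o (f \* g)%R]%E); last first.
  rewrite Lnorm1 /Rintegral fineK//.
  by apply: integrable_fin_num => //; exact: (integrable_abse (ip_integrable f2 g2)).
apply: hoelder; rewrite ?ltr0n//; try exact: L2_measurable.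
by rewrite [RHS]splitr !div1r.
Qed.

Lemma nrmD f g : f \in L2 -> g \in L2 -> nrm (fun x => f x + g x) <= nrm f + nrm g.
Proof.
move=> f2 g2; rewrite -lee_fin EFinD !L2_nrm//; last exact: L2D.
by apply: minkowski_EFin; rewrite ?ler1n//; exact: L2_measurable.
Qed.

Lemma nrmZ f a : f \in L2 -> nrm (fun x => a * f x) = `|a| * nrm f.
Proof.
move=> f2; apply/eqP; rewrite -(@eqrXn2 _ 2)//; last 2 first.
- exact: nrm_ge0.
- by rewrite mulr_ge0// nrm_ge0.
rewrite exprMn !nrm_sqr//; last exact: L2Z.
rewrite ipZr//; last exact: L2Z.
by rewrite ipC ipZr// mulrA -expr2 real_normK// num_real.
Qed.

Lemma nrmN f : f \in L2 -> nrm (fun x => - f x) = nrm f.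
Proof.
move=> f2; rewrite -[RHS]mul1r -(normr1 R) -(normrN 1) -nrmZ//.
by congr nrm; apply/funext => x; rewrite mulN1r.
Qed.

End L2.

Section curves.
Context d (T : measurableType d) (R : realType).
Variable mu : {measure set T -> \bar R}.
Local Notation L2 := (Lfun mu 2%:E).
Local Notation nrm := (nrm mu).
Local Notation ip := (ip mu).
Implicit Types (w : R -> T -> R).

Definition L2_curve w : Prop :=
  (forall t : R, 0 <= t -> w t \in L2) /\
  (forall t e : R, 0 <= t -> 0 < e -> exists2 d : R, 0 < d &
    forall r : R, 0 <= r -> `|r - t| < d -> nrm (fun x => w r x - w t x) < e).

(** The sign makes z the subgradient, not the velocity, of a gradient flow. *)
Definition right_speed w (t : R) (z : T -> R) : Prop :=
  z \in L2 /\ forall e : R, 0 < e -> exists2 d : R, 0 < d &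
    forall h : R, 0 < h < d ->
      nrm (fun x => h^-1 * (w (t + h) x - w t x) + z x) < e.

Lemma L2_curveB v w : L2_curve v -> L2_curve w ->
  L2_curve (fun t x => v t x - w t x).
Proof.
move=> [v2 vc] [w2 wc]; split=> [t t0|t e t0 e0]; first by apply: L2B; auto.
have [d1 d10 P1] := vc t (e / 2) t0 ltac:(lra).
have [d2 d20 P2] := wc t (e / 2) t0 ltac:(lra).
exists (Num.min d1 d2); first by rewrite lt_min d10.
move=> r r0; rewrite lt_min => /andP[/(P1 _ r0) A /(P2 _ r0) B].
have vv : (fun x => v r x - v t x) \in L2 by apply: L2B; auto.
have ww : (fun x => w r x - w t x) \in L2 by apply: L2B; auto.
rewrite (_ : (fun x => _) = fun x => (v r x - v t x) + - (w r x - w t x)); last first.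
  by apply/funext => x; ring.
apply: (le_lt_trans (nrmD vv (L2N ww))); rewrite nrmN//; lra.
Qed.

Lemma right_speedB v w t y z : L2_curve v -> L2_curve w -> 0 <= t ->
  right_speed v t y -> right_speed w t z ->
  right_speed (fun t x => v t x - w t x) t (fun x => y x - z x).
Proof.
move=> [v2 _] [w2 _] t0 [y2 yP] [z2 zP]; split=> [|e e0]; first exact: L2B.
have [d1 d10 P1] := yP (e / 2) ltac:(lra).
have [d2 d20 P2] := zP (e / 2) ltac:(lra).
exists (Num.min d1 d2); first by rewrite lt_min d10.
move=> h /andP[h0]; rewrite lt_min => /andP[h1 h2].
have A := P1 h ltac:(by rewrite h0). have B := P2 h ltac:(by rewrite h0).
have th0 : 0 <= t + h by lra.
have vv : (fun x => h^-1 * (v (t + h) x - v t x) + y x) \in L2.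
  by apply: L2D => //; apply: L2Z; apply: L2B; auto.
have ww : (fun x => h^-1 * (w (t + h) x - w t x) + z x) \in L2.
  by apply: L2D => //; apply: L2Z; apply: L2B; auto.
rewrite (_ : (fun x => _) = fun x => (h^-1 * (v (t + h) x - v t x) + y x) +
   - (h^-1 * (w (t + h) x - w t x) + z x)); last first.
  by apply/funext => x; ring.
apply: (le_lt_trans (nrmD vv (L2N ww))); rewrite nrmN//; lra.
Qed.

(** Chain rule for a functional F of the curve, stated through the inequality
F(y) - F(x) <= <grad F(y), y - x> that convexity provides.  As the
gradient ga is nonexpansive, freezing it at time t costs an error quadratic in
the time step.  It is applied to primitives of truncations, where
ga is a superposition operator, and to linear functionals, where ga is
constant. *)
Lemma curve_growth w (ga : (T -> R) -> T -> R) (F : R -> R) (c a b : R) :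
  L2_curve w -> 0 <= a -> a <= b ->
  (forall f, f \in L2 -> ga f \in L2) ->
  (forall f g, f \in L2 -> g \in L2 ->
    nrm (fun x => ga f x - ga g x) <= nrm (fun x => f x - g x)) ->
  (forall x y : R, 0 <= x -> 0 <= y ->
    F y - F x <= ip (ga (w y)) (fun z => w y z - w x z)) ->
  (forall t, a < t < b -> exists2 z, right_speed w t z & - ip (ga (w t)) z <= c) ->
  F b - F a <= c * (b - a).
Proof.
move=> [w2 wc] a0 ab ga2 gal FP wd.
have gaB f g : f \in L2 -> g \in L2 -> (fun x => ga f x - ga g x) \in L2.
  by move=> f2 g2; apply: L2B; auto.
have wB x y : 0 <= x -> 0 <= y -> (fun z => w x z - w y z) \in L2.
  by move=> x0 y0; apply: L2B; auto.
have ga_split f g u : f \in L2 -> g \in L2 -> u \in L2 ->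
    ip (ga g) u = ip (ga f) u + ip (fun x => ga g x - ga f x) u.
  move=> f2 g2 u2; rewrite ipC [ip (ga f) u]ipC [ip (fun=> _) u]ipC -ipDr; auto.
  by congr (ip _ _); apply/funext => x; ring.
apply: dini_growth ab => [t e /andP[at_ _] e0|t e /andP[at_ tb] e0].
  have t0 : 0 <= t := le_trans a0 at_.
  pose K := nrm (ga (w t)).
  have K0 : 0 <= K := nrm_ge0 _ _.
  have K1 : 0 < K + 1 by rewrite ltr_wpDl.
  have [dl dl0 P] := wc t (Num.min 1 (e / (K + 1))) t0
    ltac:(by rewrite lt_min ltr01 divr_gt0).
  exists dl => // r /andP[ar _] rt.
  have r0 : 0 <= r := le_trans a0 ar.
  have := P r r0 rt; rewrite lt_min => /andP[D1 D2].
  set D := nrm _ in D1 D2; have D0 : 0 <= D := nrm_ge0 _ _.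
  rewrite ltr_pdivlMr// in D2.
  have D2' : D * D <= D by rewrite ler_piMr// ltW.
  have E1 : F t - F r <= K * D.
    apply: (le_trans (FP r t r0 t0)); apply: (le_trans (ler_norm _)).
    apply: (le_trans (ip_le (ga2 _ (w2 _ t0)) (wB t r t0 r0))).
    rewrite ler_wpM2l// /D -nrmN//; last exact: wB.
    by rewrite le_eqVlt; apply/orP; left; apply/eqP; congr (nrm _); apply/funext => x; ring.
  have E2 : F r - F t <= (K + D) * D.
    apply: (le_trans (FP t r t0 r0)).
    rewrite (ga_split (w t)); auto; rewrite mulrDl; apply: lerD.
      by apply: (le_trans (ler_norm _)); apply: ip_le; auto.
    apply: (le_trans (ler_norm _)).
    apply: (le_trans (ip_le (gaB _ _ (w2 _ r0) (w2 _ t0)) (wB r t r0 t0))).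
    by rewrite ler_wpM2r//; apply: gal; auto.
  by rewrite ltr_norml; apply/andP; split; lra.
have t0 : 0 < t := le_lt_trans a0 at_.
have t0' := ltW t0.
have [z [z2 zP] zc] := wd t ltac:(by rewrite at_ tb).
pose K := nrm (ga (w t)).
have K0 : 0 <= K := nrm_ge0 _ _.
have K1 : 0 < K + 1 by rewrite ltr_wpDl.
pose V := nrm z.
have V0 : 0 <= V := nrm_ge0 _ _.
have V1 : 0 < (1 + V) ^+ 2 by rewrite exprn_gt0//; lra.
have [dl dl0 P] := zP (Num.min 1 (e / 2 / (K + 1)))
    ltac:(by rewrite lt_min ltr01 !divr_gt0).
exists (Num.min dl (e / 2 / (1 + V) ^+ 2)); first by rewrite lt_min dl0 !divr_gt0.
move=> h /andP[h0]; rewrite lt_min => /andP[h1 h2].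
have th0 : 0 <= t + h by lra.
have := P h ltac:(by rewrite h0); rewrite lt_min => /andP[].
pose r x := h^-1 * (w (t + h) x - w t x) + z x.
rewrite -/r => D1 D2.
set D := nrm r in D1 D2; have D0 : 0 <= D := nrm_ge0 _ _.
rewrite ltr_pdivlMr// in D2. rewrite ltr_pdivlMr// in h2.
have r2 : r \in L2 by apply: L2D => //; apply: L2Z; apply: wB.
have u2 : (fun x => r x - z x) \in L2 by exact: L2B.
have wE : (fun x => w (t + h) x - w t x) = (fun x => h * (r x - z x)).
  by apply/funext => x; rewrite /r; field; rewrite gt_eqF.
have nw : nrm (fun x => w (t + h) x - w t x) <= h * (1 + V).
  rewrite wE nrmZ// gtr0_norm// ler_wpM2l ?(ltW h0)//.
  apply: (le_trans (nrmD r2 (L2N z2))); rewrite nrmN// -/D -/V; lra.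
have nw0 : 0 <= nrm (fun x => w (t + h) x - w t x) by exact: nrm_ge0.
have := FP t (t + h) t0' th0.
rewrite (ga_split (w t)); auto.
have : ip (fun x => ga (w (t + h)) x - ga (w t) x)
          (fun z => w (t + h) z - w t z) <= (h * (1 + V)) ^+ 2.
  apply: (le_trans (ler_norm _)).
  apply: (le_trans (ip_le (gaB _ _ (w2 _ th0) (w2 _ t0')) (wB _ _ th0 t0'))).
  rewrite expr2; apply: ler_pM => //; first exact: nrm_ge0.
  by apply: le_trans nw; apply: gal; auto.
have : ip (ga (w t)) (fun z => w (t + h) z - w t z) <= h * (K * D + c).
  rewrite wE ipZr//; last by auto.
  rewrite ler_wpM2l ?(ltW h0)// ipBr//; last by auto.
  apply: lerD => //; apply: (le_trans (ler_norm _)); apply: ip_le; auto.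
have : h * (K * D) <= h * (e / 2) by rewrite ler_wpM2l ?(ltW h0)//; lra.
have : (h * (1 + V)) ^+ 2 <= h * (e / 2).
  by rewrite exprMn expr2 -mulrA ler_wpM2l ?(ltW h0)// ltW.
have -> : (c + e) * h = h * c + h * (e / 2) + h * (e / 2) by field.
by rewrite mulrDr; lra.
Qed.

End curves.

(** * The energy, its subdifferential and its gradient flows *)

Section nonneg_sums.
Context d (T : measurableType d) (R : realType) (m : {measure set T -> \bar R}).
Local Open Scope ereal_scope.

Lemma le_integral_sum2 (k : R) (F1 F2 G1 G2 : T -> R) : (0 <= k)%R ->
  (forall z, [/\ 0 <= F1 z, 0 <= F2 z, 0 <= G1 z & 0 <= G2 z]%R) ->
  [/\ measurable_fun setT F1, measurable_fun setT F2, measurable_fun setT G1 &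
      measurable_fun setT G2] ->
  (forall z, F1 z + F2 z <= G1 z + G2 z)%R ->
  k%:E * \int[m]_z (F1 z)%:E + k%:E * \int[m]_z (F2 z)%:E <=
  k%:E * \int[m]_z (G1 z)%:E + k%:E * \int[m]_z (G2 z)%:E.
Proof.
move=> k0 F0 [mF1 mF2 mG1 mG2] FG.
have f1 z : setT z -> 0 <= (F1 z)%:E by rewrite lee_fin; case: (F0 z).
have f2 z : setT z -> 0 <= (F2 z)%:E by rewrite lee_fin; case: (F0 z).
have g1 z : setT z -> 0 <= (G1 z)%:E by rewrite lee_fin; case: (F0 z).
have g2 z : setT z -> 0 <= (G2 z)%:E by rewrite lee_fin; case: (F0 z).
move/measurable_EFinP in mF1; move/measurable_EFinP in mF2.
move/measurable_EFinP in mG1; move/measurable_EFinP in mG2.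
rewrite -!ge0_muleDr; try exact: integral_ge0.
apply: lee_wpmul2l; first by rewrite lee_fin.
rewrite -!ge0_integralD//.
apply: ge0_le_integral => //.
- by move=> z _; apply: adde_ge0; [exact: f1|exact: f2].
- exact: emeasurable_funD.
- exact: emeasurable_funD.
- by move=> z _; rewrite -!EFinD lee_fin.
Qed.

End nonneg_sums.

(** Adding two subgradient inequalities and cancelling the finite energies a and
b. *)
Lemma ereal_subgradient_sum {R : realType} (a b c e : \bar R) (x y : R) :
  (0 <= a -> 0 <= b -> a < +oo -> b < +oo ->
   a + x%:E <= c -> b + y%:E <= e -> c + e <= a + b -> (x + y <= 0)%R)%E.
Proof.
move=> a0 b0; rewrite -!ge0_fin_numE// => /fineK <- /fineK <- A B C.
have := le_trans (leeD A B) C.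
by rewrite -!EFinD lee_fin; lra.
Qed.

Section energy.
Context {R : realType} {N : nat}.
Local Notation E := 'rV[R]_N.
Local Notation mu := (@lebesgue_rV R N).
Local Notation L2 := (Lfun mu 2%:E).
Local Notation nrm := (nrm mu).
Local Notation ip := (ip mu).
Variables (s p : R).
Hypotheses (hp : 1 < p < 2).
Implicit Types (f g u v xi eta : E -> R).

Let p0 : 0 < p. Proof. by case/andP: hp => + _; apply: lt_trans. Qed.
Let ip0 : 0 < (2 * p)^-1. Proof. by rewrite invr_gt0 mulr_gt0. Qed.

Definition kern (z : E * E) : R := (enorm (z.1 - z.2) `^ (N%:R + s * p))^-1.

Lemma kern_ge0 z : 0 <= kern z.
Proof. by rewrite invr_ge0 powR_ge0. Qed.

Lemma kern_sym x y : kern (x, y) = kern (y, x).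
Proof.
rewrite /kern /enorm /=; congr ((Num.sqrt _ `^ _)^-1); apply: eq_bigr => i _.
by rewrite !mxE -sqrrN opprB.
Qed.

Lemma measurable_enorm_sub : measurable_fun [set: E * E] (fun z => enorm (z.1 - z.2)).
Proof.
rewrite [X in measurable_fun _ X](_ : _ =
    fun z : E * E => (\sum_i (z.1 - z.2) ord0 i ^+ 2) `^ 2^-1); last first.
  apply/funext => z; rewrite powR12_sqrt//.
  by apply: sumr_ge0 => i _; exact: sqr_ge0.
apply: (@measurableT_comp _ _ _ _ _ _ (@powR R ^~ _)); first exact: measurable_powR.
apply: measurable_sum => i; apply: measurable_funX.
rewrite [X in measurable_fun _ X](_ : _ = fun z : E * E => z.1 ord0 i - z.2 ord0 i); last first.
  by apply/funext => z; rewrite !mxE.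
apply: measurable_funB.
  exact: (measurableT_comp (measurable_coord i) measurable_fst).
exact: (measurableT_comp (measurable_coord i) measurable_snd).
Qed.

Lemma measurable_kern : measurable_fun [set: E * E] kern.
Proof.
rewrite [X in measurable_fun _ X](_ : _ = fun z => enorm (z.1 - z.2) `^ (- (N%:R + s * p))).
  apply: (@measurableT_comp _ _ _ _ _ _ (@powR R ^~ _)); first exact: measurable_powR.
  exact: measurable_enorm_sub.
by apply/funext => z; rewrite powRN.
Qed.

Lemma measurable_diff f : measurable_fun [set: E] f ->
  measurable_fun [set: E * E] (fun z => f z.1 - f z.2).
Proof.
move=> mf; apply: measurable_funB; first exact: (measurableT_comp mf measurable_fst).
exact: (measurableT_comp mf measurable_snd).
Qed.

Lemma measurable_pair_term f q : measurable_fun [set: E] f ->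
  measurable_fun [set: E * E] (fun z => (`|f z.1 - f z.2| `^ q * kern z)%:E).
Proof.
move=> mf; apply/measurable_EFinP; apply: measurable_funM; last exact: measurable_kern.
apply: (@measurableT_comp _ _ _ _ _ _ (@powR R ^~ _)); first exact: measurable_powR.
by apply: measurableT_comp => //; exact: measurable_diff.
Qed.

Lemma energyE f : energy s p f = ((2 * p)^-1%:E *
  \int[mu \x mu]_z (`|f z.1 - f z.2| `^ p * kern z)%:E)%E.
Proof. by []. Qed.

Lemma pair_integral_ge0 f q :
  (0 <= \int[mu \x mu]_z (`|f z.1 - f z.2| `^ q * kern z)%:E)%E.
Proof. by apply: integral_ge0 => z _; rewrite lee_fin mulr_ge0 ?powR_ge0 ?kern_ge0. Qed.

Lemma energy_ge0 f : (0 <= energy s p f)%E.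
Proof. by rewrite energyE mule_ge0 ?pair_integral_ge0// lee_fin ltW. Qed.

Lemma energy0 : energy s p (fun _ : E => 0 : R) = 0%E.
Proof.
rewrite energyE integral0_eq ?mule0// => z _.
by rewrite subrr normr0 powR0 ?mul0r// gt_eqF.
Qed.

(** Transferring g from u to v replaces every pair of increments of u and v by
convex combinations of the two. *)
Lemma energy_exchange u v g :
  measurable_fun [set: E] u -> measurable_fun [set: E] v -> measurable_fun [set: E] g ->
  (forall x y, exists2 th, 0 <= th <= 1 &
    g x - g y = th * ((u x - v x) - (u y - v y))) ->
  (energy s p (fun x => u x - g x)%R + energy s p (fun x => v x + g x)%R <=
   energy s p u + energy s p v)%E.
Proof.
move=> m_u mv mg gP.
pose a x := u x - g x; pose b x := v x + g x.
have ma : measurable_fun [set: E] a by exact: measurable_funB.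
have mb : measurable_fun [set: E] b by exact: measurable_funD.
have nn f z : 0 <= `|f z.1 - f z.2| `^ p * kern z.
  by rewrite mulr_ge0 ?powR_ge0 ?kern_ge0.
apply: (@le_integral_sum2 _ _ _ (mu \x mu)%E (2 * p)^-1
  (fun z => `|a z.1 - a z.2| `^ p * kern z) (fun z => `|b z.1 - b z.2| `^ p * kern z)
  (fun z => `|u z.1 - u z.2| `^ p * kern z) (fun z => `|v z.1 - v z.2| `^ p * kern z)).
- exact: ltW.
- by move=> z; split; exact: nn.
- by split; apply/measurable_EFinP; exact: measurable_pair_term.
move=> [x y] /=; rewrite -!mulrDl ler_wpM2r ?kern_ge0// /a /b.
have [th th01 gxy] := gP x y.
have -> : u x - g x - (u y - g y) =
    (u x - u y) - th * ((u x - u y) - (v x - v y)).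
  by move: gxy; lra.
have -> : v x + g x - (v y + g y) =
    (v x - v y) + th * ((u x - u y) - (v x - v y)).
  by move: gxy; lra.
by apply: norm_powR_exchange => //; apply: ltW; case/andP: hp.
Qed.

(** Monotonicity of the subdifferential against a function g of u - v instead of
u - v itself: test the subgradient of u with u - g and that of v with v + g. *)
Lemma subdiff_monotone u v xi eta g :
  subdiff_energy s p u xi -> subdiff_energy s p v eta -> g \in L2 ->
  (forall x y, exists2 th, 0 <= th <= 1 &
    g x - g y = th * ((u x - v x) - (u y - v y))) ->
  0 <= ip g (fun x => xi x - eta x).
Proof.
move=> [u2 Ju x2 uP] [v2 Jv e2 vP] g2 gP.
have := energy_exchange (L2_measurable u2) (L2_measurable v2) (L2_measurable g2) gP.
have := uP _ (L2B u2 g2); have := vP _ (L2D v2 g2).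
rewrite (_ : (fun x => (xi x * (u x - g x - u x))%:E) =
  fun x => (xi x * - g x)%:E); last by apply/funext => x; congr EFin; ring.
rewrite (_ : (fun x => (eta x * (v x + g x - v x))%:E) =
  fun x => (eta x * g x)%:E); last by apply/funext => x; congr EFin; ring.
rewrite !ip_EFin//; last exact: L2N.
rewrite ipNr// ipBr// ![ip g _]ipC.
move=> B A C; have := ereal_subgradient_sum (energy_ge0 u) (energy_ge0 v) Ju Jv A B C.
by lra.
Qed.

Definition is_flow (u : R -> E -> R) : Prop :=
  L2_curve mu u /\ forall t : R, 0 < t -> exists2 xi,
    subdiff_energy s p (u t) xi & right_speed mu u t xi.

Lemma zero_flow : is_flow (fun _ _ => 0).
Proof.
have z2 : (fun _ : E => 0 : R) \in L2.
  apply: L2P; first exact: measurable_cst.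
  by rewrite integral0_eq// => x _; rewrite expr0n.
have nz : nrm (fun=> 0) = 0.
  have E0 : (fun x : E => 0 * 0 : R) = fun=> 0 by apply/funext => x; rewrite mul0r.
  by have := nrmZ 0 z2; rewrite E0 normr0 mul0r.
split; first split => //.
- move=> t e _ e0; exists 1 => // r _ _.
  have -> : (fun _ : E => 0 - 0 : R) = fun=> 0 by apply/funext => x; rewrite subrr.
  by rewrite nz.
- move=> t t0; exists (fun=> 0).
    split => //; first by rewrite energy0.
    move=> v v2; rewrite energy0 add0e integral0_eq ?energy_ge0// => x _.
    by rewrite mul0r.
  split => // e e0; exists 1 => // h _.
  have -> : (fun _ : E => h^-1 * (0 - 0) + 0 : R) = fun=> 0.
    by apply/funext => x; rewrite subrr mulr0 addr0.
  by rewrite nz.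
Qed.

End energy.

(** * Contraction in L1 *)

Section cut.
Context {R : realType}.
Implicit Types r q e : R.

(** The truncation g of the contraction argument.  Its primitive is
cut r * (r - cut r / 2), which behaves like e * r^+ for small e. *)
Definition cut e r : R := Num.min (Num.max r 0) e.

Lemma cut_ge0 e r : 0 < e -> 0 <= cut e r.
Proof. by move=> e0; rewrite /cut le_min le_max lexx orbT ltW. Qed.

Lemma cutP e r : 0 < e -> [\/ r <= 0 /\ cut e r = 0, 0 <= r <= e /\ cut e r = r |
  e <= r /\ cut e r = e].
Proof.
move=> e0; rewrite /cut.
have [r0|r0] := lerP r 0.
  by apply: Or31; split=> //; rewrite min_l// ltW.
have [re|re] := lerP r e; first by apply: Or32; split => //; rewrite (ltW r0).
by apply: Or33; split => //; exact: ltW.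
Qed.

Lemma cut_norm e r : 0 < e -> `|cut e r| <= `|r|.
Proof.
move=> e0; rewrite ger0_norm ?cut_ge0//.
have [[r0 ->]|[/andP[r0 re] ->]|[re ->]] := cutP r e0 => //.
- exact: ler_norm.
- by rewrite (le_trans re)// ler_norm.
Qed.

Lemma cut_slope e r q : 0 < e -> exists2 th, 0 <= th <= 1 &
  cut e r - cut e q = th * (r - q).
Proof.
move=> e0.
have mono x y : x < y -> 0 <= (cut e y - cut e x) / (y - x) <= 1.
  move=> xy; have d0 : 0 < y - x by rewrite subr_gt0.
  have [H1 H2] : 0 <= cut e y - cut e x /\ cut e y - cut e x <= y - x.
    have [[y0 ->]|[/andP[y0 ye] ->]|[ye ->]] := cutP y e0;
    by have [[x0 ->]|[/andP[x0 xe] ->]|[xe ->]] := cutP x e0; split; lra.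
  by rewrite divr_ge0 ?(ltW d0)//= ler_pdivrMr// mul1r.
have [rq|qr|->] := ltgtP r q.
- exists ((cut e q - cut e r) / (q - r)); first exact: mono.
  by field; rewrite subr_eq0 gt_eqF.
- exists ((cut e r - cut e q) / (r - q)); first exact: mono.
  by field; rewrite subr_eq0 gt_eqF.
- by exists 0; rewrite ?lexx ?ler01// !subrr mulr0.
Qed.

Lemma cut_lip e r q : 0 < e -> `|cut e r - cut e q| <= `|r - q|.
Proof.
move=> e0; have [th /andP[t0 t1] ->] := cut_slope r q e0.
by rewrite normrM ger0_norm// ler_piMl.
Qed.

(** The primitive of the truncation is the maximum of c (r - c / 2) over
0 <= c <= e, so it is convex with derivative cut. *)
Lemma cut_max e r q : 0 < e ->
  cut e q * (r - cut e q / 2) <= cut e r * (r - cut e r / 2).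
Proof.
move=> e0; have c0 := cut_ge0 q e0.
have ce : cut e q <= e by rewrite /cut ge_min lexx orbT.
move: (cut e q) c0 ce => c c0 ce.
have [[r0 ->]|[/andP[r0 re] ->]|[re ->]] := cutP r e0.
- have : 0 <= c * - r by rewrite mulr_ge0// oppr_ge0.
  have := sqr_ge0 c; lra.
- have := sqr_ge0 (r - c); lra.
- have : 0 <= (e - c) * (r - (e + c) / 2) by rewrite mulr_ge0// subr_ge0//; lra.
  lra.
Qed.

Lemma cut_primitive_le e r : 0 < e -> cut e r * (r - cut e r / 2) <= e * Num.max r 0.
Proof.
move=> e0; have m0 : 0 <= Num.max r 0 by rewrite le_max lexx orbT.
have mr : r <= Num.max r 0 by rewrite le_max lexx.
move: (Num.max r 0) m0 mr => m m0 mr.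
have em : 0 <= e * m by rewrite mulr_ge0// ltW.
have [[r0 ->]|[/andP[r0 re] ->]|[re ->]] := cutP r e0; first by rewrite mul0r.
- have : 0 <= (e - r) * r by rewrite mulr_ge0// subr_ge0.
  have : 0 <= e * (m - r) by rewrite mulr_ge0 ?subr_ge0// ltW.
  have := sqr_ge0 r; lra.
- have : 0 <= e * (m - r) by rewrite mulr_ge0 ?subr_ge0// ltW.
  have := sqr_ge0 e; lra.
Qed.

Lemma cut_primitive_ge e r : 0 < e ->
  e * Num.max (r - e / 2) 0 <= cut e r * (r - cut e r / 2).
Proof.
move=> e0; have [re2|re2] := lerP (r - e / 2) 0;
have [[r0 ->]|[/andP[r0 re] ->]|[re ->]] := cutP r e0; try lra.
- have := sqr_ge0 r; lra.
- have := sqr_ge0 (r - e); lra.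
Qed.

Lemma measurable_cut e d (T : measurableType d) (f : T -> R) :
  measurable_fun setT f -> measurable_fun setT (fun x => cut e (f x)).
Proof.
move=> mf; apply: measurable_minr; last exact: measurable_cst.
by apply: measurable_maxr => //; exact: measurable_cst.
Qed.

End cut.

Section contraction.
Context {R : realType} {N : nat}.
Local Notation E := 'rV[R]_N.
Local Notation mu := (@lebesgue_rV R N).
Local Notation L2 := (Lfun mu 2%:E).
Local Notation ip := (ip mu).
Variables (s p : R).
Hypotheses (hp : 1 < p < 2).

Lemma L2_cut e f : 0 < e -> f \in L2 -> (fun x => cut e (f x)) \in L2.
Proof.
move=> e0 f2; have [] // := @L2_dom _ _ _ mu f (fun x => cut e (f x)) _ f2.
- exact: (measurable_cut _ (L2_measurable f2)).
- by move=> x; exact: cut_norm.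
Qed.

Definition cut_mass e (f : E -> R) : R :=
  ip (fun x => cut e (f x)) (fun x => f x - cut e (f x) / 2).

Lemma flow_cut_mass e (u v : R -> E -> R) (t : R) : 0 < e ->
  is_flow s p u -> is_flow s p v -> 0 <= t ->
  cut_mass e (fun x => u t x - v t x) <= cut_mass e (fun x => u 0 x - v 0 x).
Proof.
move=> e0 [cu fu] [cv fv] t0.
pose w r x := u r x - v r x.
rewrite -/(w t) -/(w 0).
have cw : L2_curve mu w by exact: L2_curveB.
have c2 f : f \in L2 -> (fun x => cut e (f x)) \in L2 by exact: L2_cut.
have h2 f : f \in L2 -> (fun x => cut e (f x) / 2) \in L2.
  by move=> /c2; exact: L2Zr.
suff : cut_mass e (w t) - cut_mass e (w 0) <= 0 * (t - 0) by rewrite mul0r subr_le0.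
apply: (@curve_growth _ _ _ mu w (fun f x => cut e (f x))
  (fun r => cut_mass e (w r))) => //.
- move=> f g f2 g2.
  have [] // := @L2_dom _ _ _ mu (fun x => f x - g x)
    (fun x => cut e (f x) - cut e (g x)) _ (L2B f2 g2).
  + apply: measurable_funB; apply: measurable_cut; first exact: (L2_measurable f2).
    exact: (L2_measurable g2).
  + by move=> x; exact: cut_lip.
- move=> x y x0 y0.
  have wx : w x \in L2 by apply: (proj1 cw).
  have wy : w y \in L2 by apply: (proj1 cw).
  have -> : ip (fun z => cut e (w y z)) (fun z => w y z - w x z) =
      ip (fun z => cut e (w y z)) (fun z => w y z - cut e (w y z) / 2) -
      ip (fun z => cut e (w y z)) (fun z => w x z - cut e (w y z) / 2).
    rewrite -ipBr; auto; last 2 first.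
    - by apply: L2B; auto.
    - by apply: L2B; auto.
    by congr (ip _ _); apply/funext => z; ring.
  rewrite lerD2l lerN2; apply: le_Rintegral => //.
  + by apply: ip_integrable; auto; apply: L2B; auto.
  + by apply: ip_integrable; auto; apply: L2B; auto.
  + by move=> z _; exact: cut_max.
- move=> r /andP[r0 rt].
  have [xi sx rx] := fu r r0; have [eta se re] := fv r r0.
  exists (fun x => xi x - eta x); first by apply: right_speedB => //; exact: ltW.
  rewrite oppr_le0; apply: (subdiff_monotone hp sx se).
    by apply: c2; apply: (proj1 cw); exact: ltW.
  by move=> x y; exact: cut_slope.
Qed.

(** The primitives of the truncations at level e, divided by e, increase to the
positive part; each of their integrals is nonincreasing in time. *)
Lemma flow_L1_contraction (u v : R -> E -> R) (t : R) :
  is_flow s p u -> is_flow s p v -> 0 <= t ->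
  (\int[mu]_x (Num.max (u t x - v t x) 0)%:E <=
   \int[mu]_x (Num.max (u 0 x - v 0 x) 0)%:E)%E.
Proof.
move=> fu fv t0.
pose w r x := u r x - v r x.
have cw : L2_curve mu w by apply: L2_curveB; [case: fu|case: fv].
have w2 r : 0 <= r -> w r \in L2 by move=> r0; apply: (proj1 cw).
have mw r : 0 <= r -> measurable_fun setT (w r) by move=> /w2/L2_measurable.
have mmax (c r : R) : 0 <= r -> measurable_fun setT (fun x => (Num.max (w r x - c) 0)%:E).
  move=> r0; apply/measurable_EFinP; apply: measurable_maxr; last exact: measurable_cst.
  by apply: measurable_funB; [exact: mw|exact: measurable_cst].
have mmax0 : measurable_fun setT (fun x => (Num.max (w 0 x) 0)%:E).
  apply/measurable_EFinP; apply: measurable_maxr; last exact: measurable_cst.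
  exact: mw.
have max0 (c : R) : 0 <= Num.max c 0 by rewrite le_max lexx orbT.
have lev e : 0 < e -> (\int[mu]_x (Num.max (w t x - e / 2) 0)%:E <=
    \int[mu]_x (Num.max (w 0%R x) 0)%:E)%E.
  move=> e0.
  have prim r : 0 <= r -> (\int[mu]_x (cut e (w r x) * (w r x - cut e (w r x) / 2))%:E =
      (cut_mass e (w r))%:E)%E.
    move=> r0; apply: ip_EFin; first by apply: L2_cut; auto.
    apply: L2B; first exact: w2.
    exact: (L2Zr _ (L2_cut e0 (w2 r r0))).
  have mprim r : 0 <= r -> measurable_fun setT
      (fun x => (cut e (w r x) * (w r x - cut e (w r x) / 2))%:E).
    move=> r0; apply/measurable_EFinP.
    apply: measurable_funM; first by apply: measurable_cut; exact: mw.
    apply: measurable_funB; first exact: mw.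
    by apply: measurable_funM; [apply: measurable_cut; exact: mw|exact: measurable_cst].
  have pos : (0 < e%:E)%E by rewrite lte_fin.
  rewrite -(lee_pmul2l _ pos)//.
  rewrite -!ge0_integralZl//; try by [move=> x _; rewrite lee_fin|exact: mmax|rewrite lee_fin ltW].
  apply: le_trans (_ : (\int[mu]_x (cut e (w t x) * (w t x - cut e (w t x) / 2))%:E <= _)%E).
    apply: ge0_le_integral => //=.
    - by move=> x _; rewrite -EFinM lee_fin mulr_ge0// ltW.
    - by apply: measurable_funeM; exact: mmax.
    - exact: mprim.
    - by move=> x _; rewrite -EFinM lee_fin cut_primitive_ge.
  rewrite prim//.
  apply: (@le_trans _ _ (\int[mu]_x (cut e (w 0%R x) * (w 0%R x - cut e (w 0%R x) / 2))%:E)%E).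
    by rewrite prim// lee_fin; exact: flow_cut_mass.
  apply: ge0_le_integral => //=.
  - move=> x _; rewrite lee_fin; apply: le_trans (cut_primitive_ge _ e0).
    by rewrite mulr_ge0// ltW.
  - exact: mprim.
  - by apply: measurable_funeM.
  - by move=> x _; rewrite -EFinM lee_fin cut_primitive_le.
pose h (n : nat) x := (Num.max (w t x - n.+1%:R^-1 / 2) 0)%:E.
have hlim x : h n x @[n --> \oo] --> (Num.max (w t x) 0)%:E.
  apply: cvg_EFin; first by near=> n.
  apply: (@squeeze_cvgr _ _ _ _ (fun n : nat => Num.max (w t x) 0 - n.+1%:R^-1)
     (fun=> Num.max (w t x) 0)); last 2 first.
  - rewrite -[X in _ --> X]subr0; apply: cvgB; first exact: cvg_cst.
    exact: cvg_harmonic.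
  - exact: cvg_cst.
  near=> n; rewrite /h /=.
  have n0 : 0 < n.+1%:R^-1 :> R by rewrite invr_gt0.
  move: (n.+1%:R^-1) n0 => e e0.
  apply/andP; split.
    rewrite lerBlDr ge_max; apply/andP; split.
      by rewrite -lerBlDr le_max; apply/orP; left; lra.
    by rewrite addr_ge0// ltW.
  by rewrite ge_max max0 andbT le_max; apply/orP; left; lra.
have := @cvg_monotone_convergence _ _ _ mu setT measurableT h.
have -> : (fun x => limn (h ^~ x)) = (fun x => (Num.max (w t x) 0)%:E).
  by apply/funext => x; apply/cvg_lim => //.
move=> MC; have {MC} : (\int[mu]_x h n x)%E @[n --> \oo] --> (\int[mu]_x (Num.max (w t x) 0)%:E)%E.
  apply: MC.
  - by move=> n; exact: mmax.
  - by move=> n x _; rewrite lee_fin.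
  - move=> x _ m n mn; rewrite lee_fin ge_max max0 andbT le_max; apply/orP; left.
    by rewrite lerD2l lerN2 ler_pM2r// lef_pV2 ?posrE// ler_nat.
move=> Hc; rewrite -(cvg_lim _ Hc)//; apply: lime_le.
  by apply/cvg_ex; exists (\int[mu]_x (Num.max (w t x) 0)%:E)%E.
by apply: nearW => n; apply: lev; rewrite invr_gt0.
Unshelve. all: by end_near.
Qed.

End contraction.

(** * The semigroup *)

Section ae.
Context d (T : measurableType d) (R : realType).
Variable mu : {measure set T -> \bar R}.
Implicit Types f g h : T -> R.

Lemma integral_pospart_eq0 h : measurable_fun setT h ->
  (\int[mu]_x (Num.max (h x) 0)%:E <= 0)%E -> {ae mu, forall x, h x <= 0}.
Proof.
move=> mh h0.
have mm : measurable_fun setT (fun x => (Num.max (h x) 0)%:E).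
  by apply/measurable_EFinP; apply: measurable_maxr => //; exact: measurable_cst.
have : (\int[mu]_x `|(Num.max (h x) 0)%:E| = 0)%E.
  apply/eqP; rewrite eq_le; apply/andP; split; last exact: integral_ge0.
  apply: le_trans h0; rewrite le_eqVlt; apply/orP; left; apply/eqP.
  by apply: eq_integral => x _; rewrite gee0_abs// lee_fin le_max lexx orbT.
move/(ae_eq_integral_abs _ measurableT mm); apply: filterS => x /(_ I) [] /=.
by move=> <-; rewrite le_max lexx.
Qed.

Lemma measurable_pospartB f g : measurable_fun setT f -> measurable_fun setT g ->
  measurable_fun setT (fun x => (Num.max (f x - g x) 0)%:E).
Proof.
move=> mf mg; apply/measurable_EFinP; apply: measurable_maxr; last exact: measurable_cst.
exact: measurable_funB.
Qed.

Lemma eq0_integral_pospartB f g : measurable_fun setT f -> measurable_fun setT g ->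
  {ae mu, forall x, f x <= g x} -> (\int[mu]_x (Num.max (f x - g x) 0)%:E = 0)%E.
Proof.
move=> mf mg fg; rewrite -[RHS](integral0 mu setT); apply: ae_eq_integral => //.
  exact: measurable_pospartB.
by apply: filterS fg => x xfg _; rewrite max_r// subr_le0.
Qed.

(** The pointwise infimum lies below every h n, so its integral vanishes. *)
Lemma integral_to0_einfs (h : nat -> T -> \bar R) (a : nat -> \bar R) :
  (forall n, measurable_fun setT (h n)) -> (forall n x, 0 <= h n x)%E ->
  (forall n, \int[mu]_x h n x <= a n)%E -> a n @[n --> \oo] --> 0%E ->
  {ae mu, forall x, einfs (h ^~ x) 0%N = 0%E}.
Proof.
move=> mh h0 ha a0.
have i0 x : (0 <= einfs (h ^~ x) 0%N)%E by apply: le_ereal_inf_tmp => _ [n _ <-].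
have mi := measurable_fun_einfs mh 0%N.
have le n : (\int[mu]_x einfs (h ^~ x) 0%N <= a n)%E.
  apply: le_trans (ha n); apply: ge0_le_integral => //.
  by move=> x _; apply: ereal_inf_lbound; exists n.
have : (\int[mu]_x `|einfs (h ^~ x) 0%N| = 0)%E.
  apply/eqP; rewrite eq_le; apply/andP; split; last exact: integral_ge0.
  under eq_integral => x _ do rewrite gee0_abs//.
  rewrite -(cvg_lim _ a0)//; apply: lime_ge; first by apply/cvg_ex; exists 0%E.
  by apply: nearW.
by move/(ae_eq_integral_abs _ measurableT mi); apply: filterS => x /(_ I).
Qed.

Lemma Loo_bounded f : f \in Lfun mu +oo%E -> exists M, {ae mu, forall x, `|f x| <= M}.
Proof.
rewrite inE => /andP[_ /[!inE]]; rewrite /finite_norm unlock /=.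
case: ifPn => [_|/negP mu0 _].
  by move=> /ess_supr_bounded.
exists 0; exists setT; split => //.
by apply/eqP; rewrite eq_le measure_ge0 andbT leNgt; exact/negP.
Qed.

(** If |f| <= M then f^2 <= M |f|. *)
Lemma L1_Loo_L2 f : f \in Lfun mu 1 -> f \in Lfun mu +oo%E -> f \in Lfun mu 2%:E.
Proof.
move=> f1 /Loo_bounded[M fM].
have mf : measurable_fun setT f by move: f1; rewrite inE => /andP[/[!inE]].
move/Lfun1_integrable/integrableP : f1 => [_ f1].
apply: L2P => //.
have fM' : {ae mu, forall x, setT x -> ((f x ^+ 2)%:E <= `|M|%:E * `|(f x)%:E|)%E}.
  apply: filterS fM => x xM _; rewrite -abse_EFin -EFinM lee_fin /= .
  rewrite -[f x ^+ 2]real_normK ?num_real// expr2 ler_wpM2r//.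
  exact: le_trans (ler_norm _).
apply: le_lt_trans (ae_ge0_le_integral measurableT _ _ _ _ fM') _.
- by move=> x _; rewrite lee_fin sqr_ge0.
- by apply/measurable_EFinP; exact: measurable_funX.
- by move=> x _; rewrite mule_ge0.
- by apply: measurable_funeM; apply: measurableT_comp => //; exact/measurable_EFinP.
rewrite ge0_integralZl//; last by apply: measurableT_comp => //; exact/measurable_EFinP.
by rewrite lte_mul_pinfty.
Qed.

End ae.

Section semigroup.
Context {R : realType} {N : nat}.
Local Notation E := 'rV[R]_N.
Local Notation mu := (@lebesgue_rV R N).
Local Notation L2 := (Lfun mu 2%:E).
Local Notation nrm := (nrm mu).
Variables (s p : R) (S : R -> (E -> R) -> E -> R).
Hypotheses (hp : 1 < p < 2) (hS : generated_semigroup s p S).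
Implicit Types (f g : E -> R).

Lemma semigroup_flow f : f \in L2 -> is_flow s p (fun t => S t f).
Proof.
move=> f2; have [S2 _ Sc Sd] := hS f2.
have lt_nrm g e : g \in L2 -> (L2norm g < e%:E)%E -> nrm g < e.
  by move=> g2; rewrite /L2norm -L2_nrm.
have near0 (e : R) : 0 < e -> nbhs (0%E : \bar R) [set y | (y < e%:E)%E].
  by move=> e0; apply: open_nbhs_nbhs; split; [exact: open_ereal_lt_ereal|rewrite /= lte_fin].
split; first split => // t e t0 e0.
- have /(_ _ (near0 _ e0)) := Sc t t0.
  rewrite /= /nbhs /= /within /= => /nbhs_ballP[dl /= dl0 H].
  exists dl => // r r0 rt; apply: lt_nrm; first by apply: L2B; exact: S2.
  by apply: (H r) => //; rewrite /ball /= distrC.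
- move=> t t0; have [xi sx cx] := Sd t t0; exists xi => //.
  have [_ _ x2 _] := sx; split => // e e0.
  have /(_ _ (near0 _ e0)) := cx.
  rewrite /= /nbhs /= /at_right /within /= => /nbhs_ballP[dl /= dl0 H].
  exists dl => // h /andP[h0 h1]; apply: lt_nrm.
    apply: L2D => //; apply: L2Z; apply: L2B; apply: S2; last exact: ltW.
    by rewrite addr_ge0// ltW.
  by apply: (H h) => //; rewrite /ball /= sub0r normrN gtr0_norm.
Qed.

Lemma semigroup_measurable f t : f \in L2 -> 0 <= t -> measurable_fun setT (S t f).
Proof. by move=> f2 t0; have [S2 _ _ _] := hS f2; exact: (L2_measurable (S2 t t0)). Qed.

Lemma pospart_ge0 (x : R) : (0 <= (Num.max x 0)%:E)%E.
Proof. by rewrite lee_fin le_max lexx orbT. Qed.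

Lemma semigroup_L1_contraction f g t : f \in L2 -> g \in L2 -> 0 <= t ->
  (\int[mu]_x (Num.max (S t f x - S t g x) 0)%:E <=
   \int[mu]_x (Num.max (f x - g x) 0)%:E)%E.
Proof.
move=> f2 g2 t0.
apply: (le_trans (flow_L1_contraction hp (semigroup_flow f2) (semigroup_flow g2) t0)).
rewrite le_eqVlt; apply/orP; left; apply/eqP; apply: ae_eq_integral => //.
- by apply: measurable_pospartB; exact: semigroup_measurable.
- by exact: (measurable_pospartB (L2_measurable f2) (L2_measurable g2)).
have [_ Sf _ _] := hS f2; have [_ Sg _ _] := hS g2.
by apply: filterS2 Sf Sg => x -> -> _.
Qed.

Lemma semigroup_le f g t : f \in L2 -> g \in L2 -> 0 <= t ->
  {ae mu, forall x, f x <= g x} -> {ae mu, forall x, S t f x <= S t g x}.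
Proof.
move=> f2 g2 t0 fg.
have := @integral_pospart_eq0 _ _ _ mu (fun x => S t f x - S t g x).
move=> H; have {H} : {ae mu, forall x, S t f x - S t g x <= 0}.
  apply: H; first by apply: measurable_funB; exact: semigroup_measurable.
  apply: (le_trans (semigroup_L1_contraction f2 g2 t0)).
  by rewrite (eq0_integral_pospartB (L2_measurable f2) (L2_measurable g2) fg).
by apply: filterS => x; rewrite subr_le0.
Qed.

Lemma semigroup_ge0 f t : f \in L2 -> 0 <= t ->
  {ae mu, forall x, 0 <= f x} -> {ae mu, forall x, 0 <= S t f x}.
Proof.
move=> f2 t0 f0.
have := @integral_pospart_eq0 _ _ _ mu (fun x => 0 - S t f x).
move=> H; have {H} : {ae mu, forall x, 0 - S t f x <= 0}.
  apply: H; first by apply: measurable_funB => //; exact: semigroup_measurable.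
  apply: (le_trans (flow_L1_contraction hp (zero_flow s hp) (semigroup_flow f2) t0)).
  have [_ Sf _ _] := hS f2.
  rewrite eq0_integral_pospartB//; first by apply: (semigroup_measurable f2).
  by apply: filterS2 Sf f0 => x -> xf.
by apply: filterS => x; rewrite sub0r oppr_le0.
Qed.

Lemma semigroup_L1_norm f t : f \in L2 -> 0 <= t ->
  {ae mu, forall x, 0 <= f x} ->
  (\int[mu]_x `|S t f x|%:E <= \int[mu]_x `|f x|%:E)%E.
Proof.
move=> f2 t0 f0.
have mS : measurable_fun setT (fun x => `|S t f x|%:E).
  by apply/measurable_EFinP; apply: measurableT_comp => //; exact: semigroup_measurable.
have [_ Sf _ _] := hS f2.
have := flow_L1_contraction hp (semigroup_flow f2) (zero_flow s hp) t0.
rewrite (_ : (\int[mu]_x (Num.max (S t f x - 0) 0)%:E)%E = \int[mu]_x `|S t f x|%:E)%E.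
  rewrite (_ : (\int[mu]_x (Num.max (S 0 f x - 0) 0)%:E)%E = \int[mu]_x `|f x|%:E)%E//.
  apply: ae_eq_integral => //.
  - by apply: measurable_pospartB => //; exact: semigroup_measurable.
  - by apply/measurable_EFinP; apply: measurableT_comp => //; exact: (L2_measurable f2).
  - by apply: filterS2 Sf f0 => x -> xf _; rewrite subr0 max_l// ger0_norm.
apply: ae_eq_integral => //.
- by apply: measurable_pospartB => //; exact: semigroup_measurable.
- by apply: filterS (semigroup_ge0 f2 t0 f0) => x xf _; rewrite subr0 max_l// ger0_norm.
Qed.

End semigroup.

(** * Minimal solutions *)

Lemma cvg_pospart_deficit {R : realType} (u : nat -> R) (a l : R) : a <= l ->
  u n @[n --> \oo] --> l -> (Num.max (a - u n) 0)%:E @[n --> \oo] --> 0%E.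
Proof.
move=> al ul; apply: cvg_EFin; first by near=> n.
have d0 : `|u n - l| @[n --> \oo] --> (0 : R).
  have := cvg_norm (cvgB ul (cvg_cst l)).
  by rewrite subrr normr0; apply.
apply: (squeeze_cvgr _ (cvg_cst 0) d0); near=> n => /=.
apply/andP; split; first by rewrite le_max lexx orbT.
rewrite ge_max normr_ge0 andbT; apply: (@le_trans _ _ (l - u n)).
  by rewrite lerD2r.
by rewrite distrC ler_norm.
Unshelve. all: by end_near.
Qed.

Section minimal.
Context {R : realType} {N : nat}.
Local Notation E := 'rV[R]_N.
Local Notation mu := (@lebesgue_rV R N).
Local Notation L2 := (Lfun mu 2%:E).
Variables (s p : R) (S : R -> (E -> R) -> E -> R).
Hypotheses (hp : 1 < p < 2) (hS : generated_semigroup s p S).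
Implicit Types (f g : E -> R) (fn gn : nat -> E -> R).

Lemma approx_L2 fn f n : approx_from_below fn f -> fn n \in L2.
Proof. by move=> [H _ _]; have [h1 hoo _] := H n; exact: L1_Loo_L2. Qed.

Lemma approx_le fn f : approx_from_below fn f ->
  {ae mu, forall x, forall n, fn n x <= f x}.
Proof.
move=> [_ /ae_foralln mono cv]; apply: filterS2 mono cv => x xm xc n.
rewrite -(cvg_lim _ xc)//; apply: nondecreasing_cvgn_le.
  by apply/nondecreasing_seqP.
by apply/cvg_ex; exists (f x).
Qed.

Definition sup_solution fn (t : R) (x : E) : \bar R :=
  ereal_sup (range (fun n => (S t (fn n) x)%:E)).

(** The T-contraction bounds the integrals of (S t f_m - S t g_n)^+ by those of
(f_m - g_n)^+, which tend to 0 by dominated convergence: g_n >= 0 gives the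
bound |f_m|, and the limit (f_m - g)^+ vanishes because f_m <= f <= g. *)
Lemma solution_le_sup fn gn f g m t : 0 <= t ->
  approx_from_below fn f -> approx_from_below gn g ->
  {ae mu, forall x, f x <= g x} ->
  {ae mu, forall x, ((S t (fn m) x)%:E <= sup_solution gn t x)%E}.
Proof.
move=> t0 af ag fg.
have f2 n : fn n \in L2 by exact: approx_L2 af.
have g2 n : gn n \in L2 by exact: approx_L2 ag.
have mS h : h \in L2 -> measurable_fun setT (S t h) by move=> h2; exact: (semigroup_measurable hS).
have mf h : h \in L2 -> measurable_fun setT h by move=> h2; exact: (L2_measurable h2).
have fle := approx_le af.
have [ga _ gc] := ag.
have g0 : {ae mu, forall x, forall n, 0 <= gn n x}.
  by apply: ae_foralln => n; have [] := ga n.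
have f1 : mu.-integrable setT (fun x => `|fn m x|%:E).
  have [fa _ _] := af; have [/Lfun1_integrable f1 _ _] := fa m.
  exact: (integrable_abse f1).
have a0 : (\int[mu]_x (Num.max (fn m x - gn n x) 0)%:E)%E @[n --> \oo] --> 0%E.
  have cv0 : {ae mu, forall x, setT x ->
      (Num.max (fn m x - gn n x) 0)%:E @[n --> \oo] --> 0%E}.
    apply: filterS3 fle gc fg => x xf xg xfg _; apply: cvg_pospart_deficit xg.
    exact: le_trans xfg.
  have dom : {ae mu, forall x n, setT x ->
      (`|(Num.max (fn m x - gn n x) 0)%:E| <= `|fn m x|%:E)%E}.
    apply: filterS g0 => x xg n _; rewrite gee0_abs ?pospart_ge0// lee_fin ge_max.
    rewrite normr_ge0 andbT; apply: le_trans (ler_norm _).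
    by rewrite gerBl.
  have [_ _] := dominated_convergence measurableT
    (fun n => measurable_pospartB (mf _ (f2 m)) (mf _ (g2 n))) (measurable_cst 0%E) cv0 f1 dom.
  by rewrite integral0.
have pp h1 h2 : h1 \in L2 -> h2 \in L2 ->
    measurable_fun setT (fun x => (Num.max (S t h1 x - S t h2 x) 0)%:E).
  by move=> h12 h22; exact: (measurable_pospartB (mS _ h12) (mS _ h22)).
have := @integral_to0_einfs _ _ _ mu
  (fun n x => (Num.max (S t (fn m) x - S t (gn n) x) 0)%:E) _
  (fun n => pp _ _ (f2 m) (g2 n)) (fun n x => pospart_ge0 _)
  (fun n => semigroup_L1_contraction hp hS (f2 m) (g2 n) t0) a0.
apply: filterS => x x0; rewrite leNgt; apply/negP => lt1.
have [sg|sg|sg] := ltgtP (sup_solution gn t x) -oo%E;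
  first by move: sg; rewrite ltNge leNye.
- have {}sg : sup_solution gn t x \is a fin_num.
    by rewrite fin_numElt sg/= (lt_trans lt1)// ltry.
  move: lt1; rewrite -(fineK sg) lte_fin; set c := fine _ => lt1.
  suff : ((S t (fn m) x - c)%:E <= einfs (fun n => (Num.max (S t (fn m) x - S t (gn n) x) 0)%:E) 0%N)%E.
    by rewrite x0 lee_fin subr_le0 leNgt lt1.
  apply: le_ereal_inf_tmp => _ [n _ <-]; rewrite lee_fin le_max; apply/orP; left.
  rewrite lerD2l lerN2 -lee_fin /c (fineK sg); apply: ereal_sup_ubound.
  by exists n.
- have : ((S t (gn 0%N) x)%:E <= sup_solution gn t x)%E.
    by apply: ereal_sup_ubound; exists 0%N.
  by rewrite sg.
Qed.

Lemma solution_ae_nondecreasing fn f t : 0 <= t -> approx_from_below fn f ->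
  {ae mu, forall x, {homo (fun n => (S t (fn n) x)%:E) : n m / (n <= m)%N >-> (n <= m)%E}}.
Proof.
move=> t0 af; have f2 n : fn n \in L2 by exact: approx_L2 af.
have [_ fm _] := af.
have /ae_foralln := fun n => semigroup_le hp hS (f2 n) (f2 n.+1) t0 (fm n).
by apply: filterS => x xm; apply/nondecreasing_seqP => n; rewrite lee_fin.
Qed.

Lemma solution_cvg_sup fn f t : 0 <= t -> approx_from_below fn f ->
  {ae mu, forall x, (S t (fn n) x)%:E @[n --> \oo] --> sup_solution fn t x}.
Proof.
move=> t0 /(solution_ae_nondecreasing t0); apply: filterS => x.
exact: ereal_nondecreasing_cvgn.
Qed.

Lemma sup_solution_le fn gn f g t : 0 <= t ->
  approx_from_below fn f -> approx_from_below gn g ->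
  {ae mu, forall x, f x <= g x} ->
  {ae mu, forall x, (sup_solution fn t x <= sup_solution gn t x)%E}.
Proof.
move=> t0 af ag fg.
have /ae_foralln := fun m => solution_le_sup m t0 af ag fg.
by apply: filterS => x xm; apply: ge_ereal_sup => _ [m _ <-].
Qed.

(** Each of the two suprema is at most the other one. *)
Lemma sup_solution_minimal fn f gn : approx_from_below fn f ->
  approx_from_below gn f -> limit_of_solutions S gn (sup_solution fn).
Proof.
move=> af ag t t0; split.
  have -> : sup_solution fn t = (fun x => esups (fun n => (S t (fn n) x)%:E) 0%N).
    apply/funext => x; rewrite /sup_solution /esups /=; congr ereal_sup.
    by apply/seteqP; split => _ [n _ <-]; exists n.
  apply: measurable_fun_esups => n; apply/measurable_EFinP.
  exact: (semigroup_measurable hS (approx_L2 n af)).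
have ff : {ae mu, forall x, f x <= f x} by apply: nearW.
have := solution_cvg_sup t0 ag.
apply: filterS3 (sup_solution_le t0 af ag ff) (sup_solution_le t0 ag af ff).
by move=> x xa xb; rewrite (_ : sup_solution gn t x = sup_solution fn t x)//;
  apply/eqP; rewrite eq_le xa xb.
Qed.

Lemma minimal_solutionE f u : minimal_solution S f u -> exists2 fn,
  approx_from_below fn f & forall t : R, 0 <= t ->
    measurable_fun setT (u t) /\ {ae mu, forall x, u t x = sup_solution fn t x}.
Proof.
move=> [fn af lu]; exists fn => // t t0; have [m_u cu] := lu t t0.
split => //; apply: filterS2 cu (solution_cvg_sup t0 af) => x xu xs.
by rewrite -(cvg_lim _ xu)// -(cvg_lim _ xs).
Qed.

Lemma minimal_solution_le f g u v t : minimal_solution S f u ->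
  minimal_solution S g v -> {ae mu, forall x, f x <= g x} -> 0 <= t ->
  {ae mu, forall x, (u t x <= v t x)%E}.
Proof.
move=> /minimal_solutionE[fn af uE] /minimal_solutionE[gn ag vE] fg t0.
have [_ {}uE] := uE t t0; have [_ {}vE] := vE t t0.
by apply: filterS3 uE vE (sup_solution_le t0 af ag fg) => x -> ->.
Qed.

End minimal.

Section truncation.
Context {R : realType} {N : nat}.
Local Notation E := 'rV[R]_N.
Local Notation mu := (@lebesgue_rV R N).

Definition box (r : R) : set E := [set x | forall i, `[- r, r]%classic (x ord0 i)].

Lemma box_compact r : compact (box r).
Proof.
apply: (@rV_compact _ N (fun=> `[- r, r]%classic)) => i; exact: segment_compact.
Qed.

Lemma measurable_box r : measurable (box r).
Proof.
rewrite (_ : box r = \bigcap_(i in [set: 'I_N]) ((fun x : E => x ord0 i) @^-1` `[- r, r]%classic)).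
  apply: fin_bigcap_measurable => // i _; rewrite -[X in measurable X]setTI.
  by apply: (measurable_coord i) => //; exact: measurable_itv.
by apply/seteqP; split => x /= H i; [move=> _|]; apply: H.
Qed.

Definition truncation (f : E -> R) (n : nat) (x : E) : R :=
  cut n.+1%:R (f x) * \1_(box n%:R) x.

(** Cutting at height n + 1 and restricting to the box of radius n gives an
increasing sequence of bounded integrable functions, which at each point is
eventually constant. *)
Lemma truncation_approx f : locally_integrable_rV f ->
  {ae mu, forall x, 0 <= f x} -> approx_from_below (truncation f) f.
Proof.
move=> [mf fK] f0.
have n0 n : 0 < n.+1%:R :> R by [].
have t0 n x : 0 <= truncation f n x by rewrite mulr_ge0// cut_ge0.
have mt n : measurable_fun setT (truncation f n).
  apply: measurable_funM; first exact: measurable_cut.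
  by apply: measurable_indic; exact: measurable_box.
have tn n x : truncation f n x <= n.+1%:R.
  rewrite /truncation -[leRHS]mulr1; apply: ler_pM => //; first exact: cut_ge0.
  by rewrite /cut ge_min lexx orbT.
split.
- move=> n; split; last by apply: nearW => x; exact: t0.
  + apply/Lfun1_integrable/integrableP; split; first exact/measurable_EFinP.
    apply: (@le_lt_trans _ _ (\int[mu]_(x in box n%:R) `|f x|%:E)%E); last first.
      exact: (fK _ (@box_compact n%:R)).
    rewrite [leRHS]integral_mkcond.
    apply: ge0_le_integral => //.
    * by apply: measurableT_comp => //; exact/measurable_EFinP.
    * by apply/(measurable_restrictT _ (measurable_box _))/measurable_EFinP;
        apply: measurableT_comp => //; exact: measurable_funTS.
    move=> x _; rewrite patchE /truncation /= indicE.
    case: ifPn => xb; last by rewrite mulr0 normr0.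
    by rewrite mulr1 lee_fin; exact: cut_norm.
  + rewrite inE; apply/andP; split; rewrite inE//=.
    rewrite /finite_norm unlock /=; case: ifPn => // _.
    apply: (@le_lt_trans _ _ n.+1%:R%:E); last exact: ltry.
    by apply: ess_sup_ler => x; rewrite lee_fin ger0_norm.
- move=> n; apply: nearW => x; rewrite /truncation; apply: ler_pM => //.
  + exact: cut_ge0.
  + by rewrite /cut le_min !ge_min lexx/= ler_nat leqnSn orbT.
  + rewrite !indicE ler_nat; case: (boolP (x \in box n%:R)) => // xb.
    rewrite (_ : x \in _)// inE => i; move: xb; rewrite inE => /(_ i) /=.
    by rewrite !in_itv/= => /andP[a b]; rewrite (le_trans _ a) ?(le_trans b)//
      ?lerN2 ler_nat.
- apply: filterS f0 => x x0; apply: cvg_near_cst.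
  near=> n.
  have nx : f x + \sum_i `|x ord0 i| <= n%:R by near: n; exact: nbhs_infty_ger.
  have s0 : 0 <= \sum_i `|x ord0 i| by exact: sumr_ge0.
  have xb : x \in box n%:R.
    rewrite inE => i /=; rewrite in_itv/= -ler_norml (le_trans _ nx)//.
    rewrite (bigD1 i)//= addrCA lerDl addr_ge0//; exact: sumr_ge0.
  rewrite /truncation indicE xb mulr1 /cut max_l// min_l//.
  by rewrite -natr1; lra.
Unshelve. all: by end_near.
Qed.

End truncation.

(** * Borel sets and boxes in R^N *)

Section borel.
Context {R : realType} {N : nat}.
Local Notation E := 'rV[R]_N.
Local Notation mu := (@lebesgue_rV R N).

Definition rat_cube (q : 'rV[rat]_N) (k : nat) : set E :=
  [set x | forall i, `|x ord0 i - ratr (q ord0 i)| < k.+1%:R^-1].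

Lemma measurable_rat_cube q k : measurable (rat_cube q k).
Proof.
rewrite (_ : rat_cube q k = \bigcap_(i in [set: 'I_N]) ((fun x : E => x ord0 i) @^-1`
    `]ratr (q ord0 i) - k.+1%:R^-1, ratr (q ord0 i) + k.+1%:R^-1[%classic)).
  apply: fin_bigcap_measurable => // i _; rewrite -[X in measurable X]setTI.
  by apply: (measurable_coord i) => //; exact: measurable_itv.
apply/seteqP; split => [x H i _|x H i].
  by rewrite /= in_itv/= -ltr_distl; exact: H.
by have := H i I; rewrite /= in_itv/= -ltr_distl.
Qed.

(** The product sigma-algebra contains the open sets because an open set is the
union of the countably many rational cubes that it contains. *)
Lemma open_rV_measurable (U : set E) : open U -> measurable U.
Proof.
move=> oU.
pose F (qk : 'rV[rat]_N * nat) : set E :=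
  if `[< rat_cube qk.1 qk.2 `<=` U >] then rat_cube qk.1 qk.2 else set0.
have -> : U = \bigcup_qk F qk.
  apply/seteqP; split => [x Ux|x [qk _]]; last first.
    by rewrite /F; case: asboolP => // qU; exact: qU.
  have : nbhs x U by exact: open_nbhs_nbhs.
  move=> /nbhs_ballP[e /= e0 eU].
  (* a cube of this size that contains x has diameter less than e *)
  pose k := Num.trunc (2 / e).
  have k0 : 0 < k.+1%:R^-1 :> R by rewrite invr_gt0.
  have ke : k.+1%:R^-1 * 2 < e.
    rewrite mulrC ltr_pdivrMr// mulrC -ltr_pdivrMr//; exact: truncnS_gt.
  have qP i : exists q : rat, `|x ord0 i - ratr q| < k.+1%:R^-1.
    have : x ord0 i - k.+1%:R^-1 < x ord0 i + k.+1%:R^-1 by move: (k.+1%:R^-1) k0 => *; lra.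
    move=> /rat_in_itvoo[q]; rewrite in_itv/= => /andP[q1 q2]; exists q.
    by rewrite distrC ltr_distl q1 q2.
  pose q : 'rV[rat]_N := \row_i projT1 (cid (qP i)).
  have qx : rat_cube q k x by move=> i; rewrite mxE; case: cid.
  exists (q, k) => //; rewrite /F /= ifT//.
  apply/asboolP => y yq; apply: eU; split => // i j; rewrite !ord1 /ball /=.
  have := yq j; have := qx j; move: (ratr _) => r.
  move: (k.+1%:R^-1) ke => c ke; rewrite !ltr_norml => /andP[a b] /andP[a' b'].
  by apply/andP; split; lra.
apply: countable_bigcupT_measurable; first exact: countableP.
move=> qk; rewrite /F; case: asboolP => // _; exact: measurable_rat_cube.
Qed.

Lemma continuous_rV_measurable (f : E -> R) : continuous f -> measurable_fun setT f.
Proof.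
move=> /continuousP cf; apply: (measurability _ (RGenOpens.measurableE R)).
move=> _ [_ [a [b ->] <-]]; rewrite setTI; apply: open_rV_measurable.
exact/cf/interval_open.
Qed.

Lemma locally_bounded_compact (g : E -> \bar R) (A : set E) : compact A ->
  (forall x : E, exists K : R, \forall y \near x, (g y <= K%:E)%E) ->
  exists K : R, forall x, A x -> (g x <= K%:E)%E.
Proof.
move=> /compact_near_coveringP cA gK.
have : \forall k \near +oo, A `<=` (fun x => (g x <= (k : R)%:E)%E).
  apply: (cA R (pinfty_nbhs R) (fun k x => (g x <= k%:E)%E)) => x Ax.
  have [K KP] := gK x.
  near=> y k => /=; apply: (@le_trans _ _ K%:E).
    by near: y.
  by rewrite lee_fin; near: k; apply: nbhs_pinfty_ge; exact: num_real.
move=> [M [Mr MP]]; exists (M + 1) => x Ax; apply: (MP (M + 1)) => //.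
by rewrite ltrDl.
Unshelve. all: by end_near.
Qed.

End borel.

Lemma box_finite {R : realType} (N : nat) (r : R) :
  (lebesgue_rV N (box r) < +oo)%E.
Proof.
elim: N => [|n IH]; first by rewrite /= diracE ltry.
rewrite /= /lebesgue_rV_step /pushforward.
have consl (a : R) (x : 'rV[R]_n) : rV_cons (a, x) ord0 (lshift n (@ord0 0) : 'I_(1 + n)) = a.
  by apply: etrans (row_mxEl _ _ _ _) _; rewrite mxE.
have consr (a : R) (x : 'rV[R]_n) i : rV_cons (a, x) ord0 (rshift 1 i : 'I_(1 + n)) = x ord0 i.
  exact: row_mxEr.
have -> : @rV_cons R n @^-1` box r = `[- r, r]%classic `*` box r.
  apply/seteqP; split => [[a x] H|[a x] [H1 H2] i].
    split; last by move=> i; have := H (rshift 1 i); rewrite consr.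
    by have := H (lshift n (@ord0 0)); rewrite consl.
  have [j ->|j ->] := split_ordP (i : 'I_(1 + n)); last by rewrite consr; exact: H2.
  by rewrite (ord1 j) consl.
rewrite product_measure1E//; last exact: measurable_box.
have itv_fin : (lebesgue_measure (`[(- r)%R, r]%classic : set R) < +oo)%E.
  by rewrite lebesgue_measure_itv/=; case: ifPn => // _; rewrite -EFinB ltry.
by apply: lte_mul_pinfty => //; rewrite ge0_fin_numE.
Qed.

(** * The operator M of order sp/2 as an absolutely convergent integral *)

Section symmetric_double_integral.
Context d (T : measurableType d) (R : realType).
Variable m : {sigma_finite_measure set T -> \bar R}.
Local Open Scope ereal_scope.

(** Tonelli on each of the two terms; the symmetry of G makes them equal. *)
Lemma integral_pair_sym (a : T -> R) (G : T * T -> R) :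
  measurable_fun setT a -> (forall x, 0 <= a x)%R ->
  measurable_fun setT G -> (forall z, 0 <= G z)%R ->
  (forall x y, G (x, y) = G (y, x)) ->
  \int[m \x m]_z ((a z.1 + a z.2) * G z)%:E =
  2%:E * \int[m]_x ((a x)%:E * \int[m]_y (G (x, y))%:E).
Proof.
move=> ma a0 mG G0 Gs.
have ma1 : measurable_fun setT (fun z : T * T => (a z.1 * G z)%:E).
  apply/measurable_EFinP; apply: measurable_funM => //.
  exact: (measurableT_comp ma measurable_fst).
have ma2 : measurable_fun setT (fun z : T * T => (a z.2 * G z)%:E).
  apply/measurable_EFinP; apply: measurable_funM => //.
  exact: (measurableT_comp ma measurable_snd).
have p1 (z : T * T) : 0 <= (a z.1 * G z)%:E by rewrite lee_fin mulr_ge0.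
have p2 (z : T * T) : 0 <= (a z.2 * G z)%:E by rewrite lee_fin mulr_ge0.
under eq_integral do rewrite mulrDl EFinD.
rewrite ge0_integralD//.
rewrite (@fubini_tonelli1 _ _ _ _ _ m m _ ma1 p1) (@fubini_tonelli2 _ _ _ _ _ m m _ ma2 p2).
have mGx x : measurable_fun setT (fun y => (G (x, y))%:E).
  apply/measurable_EFinP.
  exact: (measurableT_comp mG (pair1_measurable x)).
have inner x : \int[m]_y (a x * G (x, y))%:E = (a x)%:E * \int[m]_y (G (x, y))%:E.
  under eq_integral do rewrite EFinM.
  by rewrite ge0_integralZl// ?lee_fin// => y _; rewrite lee_fin.
have -> : \int[m]_x fubini_F m (fun z => (a z.1 * G z)%:E) x =
    \int[m]_x ((a x)%:E * \int[m]_y (G (x, y))%:E).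
  by apply: eq_integral => x _; rewrite /fubini_F /= inner.
have -> : \int[m]_x fubini_G m (fun z => (a z.2 * G z)%:E) x =
    \int[m]_x ((a x)%:E * \int[m]_y (G (x, y))%:E).
  apply: eq_integral => x _; rewrite /fubini_G /= -inner.
  by apply: eq_integral => y _; rewrite Gs.
by rewrite (_ : 2%:E = 1 + 1) ?ge0_muleDl ?mul1e// -EFinD -natr1.
Qed.

End symmetric_double_integral.

Section jumps.
Context {R : realType} {N : nat}.
Local Notation E := 'rV[R]_N.
Local Notation mu := (@lebesgue_rV R N).
Variables (s p : R).
Hypotheses (hs : 0 < s < 1) (hp : 1 < p < 2).
Implicit Types (phi : E -> R).

Let p0 : 0 < p. Proof. by case/andP: hp => + _; apply: lt_trans. Qed.

Definition jump_density phi (z : E * E) : R := `|phi z.1 - phi z.2| * kern s p z.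

Definition jump_integral phi (x : E) : \bar R := (\int[mu]_y (jump_density phi (x, y))%:E)%E.

Lemma jump_density_ge0 phi z : 0 <= jump_density phi z.
Proof. by rewrite mulr_ge0 ?kern_ge0. Qed.

Lemma measurable_jump_density phi : measurable_fun setT phi ->
  measurable_fun setT (jump_density phi).
Proof.
move=> mphi; apply: measurable_funM; last exact: measurable_kern.
by apply: measurableT_comp => //; exact: measurable_diff.
Qed.

Lemma measurable_jump_density1 phi x : measurable_fun setT phi ->
  measurable_fun setT (fun y => (jump_density phi (x, y))%:E).
Proof.
move=> mphi; apply/measurable_EFinP.
exact: (measurableT_comp (measurable_jump_density mphi) (pair1_measurable x)).
Qed.

Lemma measurable_jump_integral phi : measurable_fun setT phi -> measurable_fun setT (jump_integral phi).
Proof.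
move=> mphi.
apply: (@measurable_fun_fubini_tonelli_F _ _ _ _ R mu (fun z => (jump_density phi z)%:E)).
  by apply/measurable_EFinP; exact: measurable_jump_density.
by move=> z; rewrite lee_fin jump_density_ge0.
Qed.

Lemma jump_integral_ge0 phi x : (0 <= jump_integral phi x)%E.
Proof. by apply: integral_ge0 => y _; rewrite lee_fin jump_density_ge0. Qed.

(** The integrand is nonnegative, so the truncated integrals increase to the
whole one by monotone convergence; the diagonal costs nothing, since there the
kernel takes the value 0. *)
Lemma MopE phi x : measurable_fun setT phi -> Mop s p phi x = jump_integral phi x.
Proof.
move=> mphi.
pose A (e : R) : set E := [set y | e < enorm (x - y)].
have mA e : measurable (A e).
  rewrite (_ : A e = (fun y => enorm (x - y)) @^-1` `]e, +oo[%classic).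
    rewrite -[X in measurable X]setTI.
    by apply: (measurableT_comp measurable_enorm_sub (pair1_measurable x)).
  by apply/seteqP; split => y /=; rewrite in_itv/= andbT.
pose g (e : R) := (\int[mu]_(y in A e) (jump_density phi (x, y))%:E)%E.
have F0 y : (0 <= (jump_density phi (x, y))%:E)%E by rewrite lee_fin jump_density_ge0.
have mF := measurable_jump_density1 x mphi.
have gle e e' : e <= e' -> (g e' <= g e)%E.
  move=> ee; apply: ge0_subset_integral => //; first exact: measurable_funTS.
  by move=> y /=; apply: le_lt_trans.
have gc : cvg (g e @[e --> 0%R^'+]).
  by apply: nonincreasing_at_right_is_cvge; near=> b => e e' _ _; exact: gle.
have limE : Mop s p phi x = lim (g e @[e --> 0%R^'+]) by [].
have gn (n : nat) : (g (n.+1%:R^-1)%R <= Mop s p phi x)%E.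
  rewrite limE; apply: lime_ge => //; near=> e; apply: gle.
  by near: e; apply: nbhs_right_le; rewrite invr_gt0.
pose h (n : nat) := (fun y => (jump_density phi (x, y))%:E) \_ (A n.+1%:R^-1).
have hF y : h n y @[n --> \oo] --> (jump_density phi (x, y))%:E.
  apply: cvg_near_cst; have [d0|d0] := eqVneq (enorm (x - y)) 0.
    near=> n; rewrite /h patchE; case: ifPn => // _.
    rewrite /jump_density /kern /= d0 powR0 ?invr0 ?mulr0// gt_eqF//.
    by rewrite ltr_wpDl// mulr_gt0//; case/andP: hs.
  have e0 : 0 < enorm (x - y) by rewrite lt0r d0 sqrtr_ge0.
  near=> n; rewrite /h patchE ifT// inE /A /=.
  by near: n; apply: (near_infty_natSinv_lt (PosNum e0)).
have := @cvg_monotone_convergence _ _ _ mu setT measurableT h.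
have -> : (fun y => limn (h ^~ y)) = (fun y => (jump_density phi (x, y))%:E).
  by apply/funext => y; apply/cvg_lim.
move=> MC; have {}MC : (\int[mu]_y h n y)%E @[n --> \oo] --> jump_integral phi x.
  apply: MC.
  - by move=> n; apply/(measurable_restrictT _ (mA _)); exact: measurable_funTS.
  - by move=> n y _; rewrite /h patchE; case: ifPn.
  - move=> y _ i j ij; rewrite /h !patchE; case: ifPn => [yi|_]; last by case: ifPn.
    rewrite ifT//; move: yi; rewrite !inE /A /=; apply: le_lt_trans.
    by rewrite lef_pV2 ?posrE// ler_nat.
apply/eqP; rewrite eq_le; apply/andP; split.
  rewrite limE; apply: lime_le => //; near=> e.
  by rewrite /jump_integral; apply: ge0_subset_integral.
rewrite -(cvg_lim _ MC)//; apply: lime_le.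
  by apply/cvg_ex; exists (jump_integral phi x).
by apply: nearW => n; rewrite -integral_mkcond; exact: gn.
Unshelve. all: by end_near.
Qed.

End jumps.

(** * Testing a subgradient *)

(** Divide by h and let h tend to 0: the remainder h^(k-1) B vanishes. *)
Lemma subgradient_limit {R : realType} (a A B x k : R) :
  1 < k -> 0 <= B ->
  (forall h : R, 0 < h -> a + h * x <= a + h * A + h `^ k * B) -> x <= A.
Proof.
move=> k1 B0 H; have k10 : 0 < k - 1 by rewrite subr_gt0.
apply/ler_addgt0Pr => e e0.
have B1 : 0 < B + 1 by rewrite ltr_wpDl.
(* the step for which the remainder is at most e h *)
pose h := (e / (B + 1)) `^ (k - 1)^-1.
have eB : 0 < e / (B + 1) by rewrite divr_gt0.
have h0 : 0 < h by rewrite powR_gt0.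
have hk : h `^ (k - 1) = e / (B + 1).
  by rewrite /h -powRrM mulVf ?gt_eqF// powRr1// ltW.
have hB : h `^ k * B <= h * e.
  rewrite -(mulr_powRB1 (ltW h0)) ?(lt_trans ltr01)// hk -mulrA ler_wpM2l ?(ltW h0)//.
  by rewrite mulrAC ler_pdivrMr// ler_wpM2l ?(ltW e0)// lerDl.
have := H h h0 => Hh; rewrite -(ler_pM2l h0) mulrDr; lra.
Qed.

Section affine_bound.
Context d (T : measurableType d) (R : realType) (m : {measure set T -> \bar R}).
Local Open Scope ereal_scope.

Lemma le_integral_affine (b c : R) (F F1 F2 F3 : T -> R) :
  (0 <= b)%R -> (0 <= c)%R ->
  [/\ measurable_fun setT F, measurable_fun setT F1, measurable_fun setT F2 &
      measurable_fun setT F3] ->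
  (forall z, [/\ 0 <= F z, 0 <= F1 z, 0 <= F2 z & 0 <= F3 z]%R) ->
  (forall z, F z <= F1 z + (b * F2 z + c * F3 z))%R ->
  \int[m]_z (F z)%:E <=
  \int[m]_z (F1 z)%:E + (b%:E * \int[m]_z (F2 z)%:E + c%:E * \int[m]_z (F3 z)%:E).
Proof.
move=> b0 c0 [mF mF1 mF2 mF3] F0 FF.
move/measurable_EFinP in mF; move/measurable_EFinP in mF1.
move/measurable_EFinP in mF2; move/measurable_EFinP in mF3.
have f1 z : setT z -> 0 <= (F1 z)%:E by rewrite lee_fin; case: (F0 z).
have f2 z : setT z -> 0 <= (F2 z)%:E by rewrite lee_fin; case: (F0 z).
have f3 z : setT z -> 0 <= (F3 z)%:E by rewrite lee_fin; case: (F0 z).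
have bf2 z : setT z -> 0 <= b%:E * (F2 z)%:E by move=> /f2; exact: mule_ge0.
have cf3 z : setT z -> 0 <= c%:E * (F3 z)%:E by move=> /f3; exact: mule_ge0.
have mb : measurable_fun setT (fun z => b%:E * (F2 z)%:E) by exact: measurable_funeM.
have mc : measurable_fun setT (fun z => c%:E * (F3 z)%:E) by exact: measurable_funeM.
rewrite -!ge0_integralZl// -!ge0_integralD//; last 2 first.
- by move=> z zT; apply: adde_ge0; [exact: bf2|exact: cf3].
- exact: emeasurable_funD.
apply: ge0_le_integral => //.
- by move=> z _; rewrite lee_fin; case: (F0 z).
- by apply: emeasurable_funD => //; exact: emeasurable_funD.
by move=> z _; rewrite -!EFinM -!EFinD lee_fin.
Qed.

End affine_bound.

Section weak_form.
Context {R : realType} {N : nat}.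
Local Notation E := 'rV[R]_N.
Local Notation mu := (@lebesgue_rV R N).
Local Notation L2 := (Lfun mu 2%:E).
Local Notation ip := (ip mu).
Variables (s p : R).
Hypotheses (hp : 1 < p < 2).
Implicit Types (u v xi phi psi : E -> R).

Let p0 : 0 < p. Proof. by case/andP: hp => + _; apply: lt_trans. Qed.
Let p10 : 0 < p - 1. Proof. by case/andP: hp; rewrite subr_gt0. Qed.
Let p11 : p - 1 <= 1. Proof. by case/andP: hp => _ /ltW; rewrite lerBlDr. Qed.

(** The quantity that dominates the weak form of the operator: u enters only
through |u|^(p-1), and the weight only through M phi. *)
Definition jump_pairing u phi : \bar R :=
  (\int[mu]_x ((`|u x| `^ (p - 1))%:E * jump_integral s p phi x))%E.

Lemma measurable_powR_norm u q : measurable_fun setT u ->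
  measurable_fun setT (fun x => `|u x| `^ q).
Proof.
move=> m_u; apply: (@measurableT_comp _ _ _ _ _ _ (@powR R ^~ q)).
  exact: measurable_powR.
by apply: measurableT_comp.
Qed.

Lemma jump_pairing_ge0 u phi : (0 <= jump_pairing u phi)%E.
Proof.
by apply: integral_ge0 => x _; rewrite mule_ge0 ?jump_integral_ge0// lee_fin powR_ge0.
Qed.

(** The linear term of the expansion is symmetrised: |u(x)|^(p-1) and
|u(y)|^(p-1) contribute equally, and the resulting factor 2 cancels against the
factor 1/(2p) of the energy. *)
Lemma energy_perturb u psi phi h : measurable_fun setT u -> measurable_fun setT psi ->
  measurable_fun setT phi ->
  (forall x y, `|psi x - psi y| <= `|phi x - phi y|) -> 0 < h ->
  (energy s p (fun x => u x + h * psi x)%R <=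
   energy s p u + h%:E * jump_pairing u phi + (h `^ p)%:E * (p%:E * energy s p psi))%E.
Proof.
move=> m_u mpsi mphi dpsi h0.
pose c : R := (2 * p)^-1.
have c0 : 0 < c by rewrite invr_gt0 mulr_gt0.
pose F (f : E -> R) (z : E * E) := `|f z.1 - f z.2| `^ p * kern s p z.
pose a (x : E) := `|u x| `^ (p - 1).
have a0 x : 0 <= a x by exact: powR_ge0.
have ma : measurable_fun setT a by exact: measurable_powR_norm.
pose G (z : E * E) := (a z.1 + a z.2) * jump_density s p phi z.
have F0 f z : 0 <= F f z by rewrite mulr_ge0 ?powR_ge0 ?kern_ge0.
have mF f : measurable_fun setT f -> measurable_fun setT (F f).
  by move=> mf; apply/measurable_EFinP; exact: measurable_pair_term.
have G0 z : 0 <= G z by rewrite mulr_ge0 ?jump_density_ge0// addr_ge0.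
have mG : measurable_fun setT G.
  apply: measurable_funM; last exact: measurable_jump_density.
  apply: measurable_funD; first exact: (measurableT_comp ma measurable_fst).
  exact: (measurableT_comp ma measurable_snd).
have mup : measurable_fun setT (fun x => u x + h * psi x).
  by apply: measurable_funD => //; apply: measurable_funM => //; exact: measurable_cst.
have IG : (\int[mu \x mu]_z (G z)%:E = 2%:E * jump_pairing u phi)%E.
  have Gs x y : jump_density s p phi (x, y) = jump_density s p phi (y, x).
    by rewrite /jump_density kern_sym distrC.
  exact: (integral_pair_sym mu ma a0 (measurable_jump_density s p mphi)
    (@jump_density_ge0 _ _ _ _ phi) Gs).
have pt z : F (fun x => u x + h * psi x) z <= F u z + (p * h * G z + p * h `^ p * F psi z).
  case: z => x y; rewrite /F /G /jump_density /=.
  rewrite (_ : u x + h * psi x - (u y + h * psi y) =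
    (u x - u y) + h * (psi x - psi y)); last by ring.
  have k0 := kern_ge0 s p (x, y); move: (kern s p (x, y)) k0 => k k0.
  have P := norm_powR_perturb (u x - u y) (psi x - psi y) h0 hp.
  have Q : `|u x - u y| `^ (p - 1) <= a x + a y.
    apply: (@le_trans _ _ ((`|u x| + `|u y|) `^ (p - 1))).
      by rewrite ge0_ler_powR ?(ltW p10) ?nnegrE ?addr_ge0// ler_normB.
    exact: powR_subadd.
  have QD : `|u x - u y| `^ (p - 1) * `|psi x - psi y| <= (a x + a y) * `|phi x - phi y|.
    by apply: ler_pM => //; exact: powR_ge0.
  apply: (le_trans (ler_wpM2r k0 P)).
  have := ler_wpM2l (mulr_ge0 (mulr_ge0 (ltW p0) (ltW h0)) k0) QD; lra.
have ph0 : 0 <= p * h by rewrite mulr_ge0// ltW.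
have php0 : 0 <= p * h `^ p by rewrite mulr_ge0 ?powR_ge0// ltW.
have := @le_integral_affine _ _ _ (mu \x mu)%E _ _ _ _ _ _ ph0 php0
  (And4 (mF _ mup) (mF _ m_u) mG (mF _ mpsi))
  (fun z => And4 (F0 _ z) (F0 _ z) (G0 z) (F0 _ z)) pt.
rewrite IG.
have EF f : energy s p f = (c%:E * \int[mu \x mu]_z (F f z)%:E)%E by [].
have IF0 f : (0 <= \int[mu \x mu]_z (F f z)%:E)%E.
  by apply: integral_ge0 => z _; rewrite lee_fin.
rewrite !EF.
move: (\int[mu \x mu]_z (F u z)%:E)%E (IF0 u) => Iu Iu0.
move: (\int[mu \x mu]_z (F psi z)%:E)%E (IF0 psi) => Ipsi Ipsi0.
move: (\int[mu \x mu]_z (F (fun x => u x + h * psi x)%R z)%:E)%E => I.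
move: (jump_pairing u phi) (jump_pairing_ge0 u phi) => tr tr0 HI.
apply: (le_trans (lee_wpmul2l _ HI)); first by rewrite lee_fin ltW.
rewrite ge0_muleDr//; last first.
  by rewrite adde_ge0// !mule_ge0// lee_fin ?ltW.
rewrite ge0_muleDr//; try by rewrite !mule_ge0// lee_fin ?ltW.
rewrite !muleA -!EFinM addeA le_eqVlt; apply/orP; left; apply/eqP.
congr (_ + _ * _ + _ * _)%E; congr EFin; rewrite /c; field; rewrite gt_eqF//.
Qed.

(** The subgradient inequality at u + h psi, with the energy expanded in h. *)
Lemma weak_bound u xi psi phi : subdiff_energy s p u xi -> psi \in L2 ->
  measurable_fun setT phi -> (energy s p psi < +oo)%E ->
  (forall x y, `|psi x - psi y| <= `|phi x - phi y|) ->
  ((ip xi psi)%:E <= jump_pairing u phi)%E.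
Proof.
move=> [u2 Ju x2 uP] psi2 mphi Jpsi dpsi.
have m_u := L2_measurable u2; have mpsi := L2_measurable psi2.
have H (h : R) : 0 < h -> (energy s p u + (h * ip xi psi)%:E <=
   energy s p u + h%:E * jump_pairing u phi + (h `^ p)%:E * (p%:E * energy s p psi))%E.
  move=> h0; apply: le_trans (energy_perturb m_u mpsi mphi dpsi h0).
  have := uP _ (L2D u2 (L2Z h psi2)).
  rewrite (_ : (fun x => (xi x * (u x + h * psi x - u x))%:E) =
    fun x => (xi x * (h * psi x))%:E); last by apply/funext => x; congr EFin; ring.
  by rewrite ip_EFin ?ipZr//; exact: L2Z.
have := energy_ge0 s hp u; have := energy_ge0 s hp psi.
move: (energy s p u) (energy s p psi) Ju Jpsi H => a b.
have [->|trfin] := eqVneq (jump_pairing u phi) +oo%E; first by rewrite leey.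
have {}trfin : jump_pairing u phi \is a fin_num.
  by rewrite ge0_fin_numE ?jump_pairing_ge0// ltey.
move=> ay by_ H b0 a0; move: ay by_ H.
rewrite -ge0_fin_numE// -[(b < _)%E]ge0_fin_numE// => /fineK <- /fineK bE.
move: b0; rewrite -bE -(fineK trfin) !lee_fin => b0 H.
apply: (@subgradient_limit _ (fine a) _ (p * fine b) _ p) => //.
- by case/andP: hp.
- by rewrite mulr_ge0// ltW.
Qed.

End weak_form.

(** * Weights of class C(s,p) *)

Section weights.
Context {R : realType} {N : nat}.
Local Notation E := 'rV[R]_N.
Local Notation mu := (@lebesgue_rV R N).
Local Notation L2 := (Lfun mu 2%:E).
Variables (s p : R) (phi : E -> R).
Hypotheses (hs : 0 < s < 1) (hp : 1 < p < 2) (hphi : class_C s p phi).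

Let p0 : 0 < p. Proof. by case/andP: hp => + _; apply: lt_trans. Qed.
Let p10 : 0 < p - 1. Proof. by case/andP: hp; rewrite subr_gt0. Qed.
Let p20 : 0 < 2 - p. Proof. by case/andP: hp; rewrite subr_gt0. Qed.

Lemma weight_gt0 x : 0 < phi x. Proof. by case: hphi. Qed.

Lemma weight_continuous : continuous phi.
Proof. by case: hphi => /(_ [::])[]. Qed.

Lemma weight_measurable : measurable_fun setT phi.
Proof. exact: continuous_rV_measurable weight_continuous. Qed.

Lemma coord_le_enorm (x : E) i : `|x ord0 i| <= enorm x.
Proof.
rewrite -sqrtr_sqr /enorm ler_sqrt ?sumr_ge0//; last by move=> j _; exact: sqr_ge0.
by rewrite (bigD1 i)//= lerDl sumr_ge0// => j _; exact: sqr_ge0.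
Qed.

Lemma weight_small c : 0 < c -> exists r : R, forall x, ~ box r x -> phi x < c.
Proof.
move=> c0; case: hphi => _ _ /(_ c c0)[M MP] _ _; exists M => x xM.
rewrite -(gtr0_norm (weight_gt0 x)); apply: MP; rewrite ltNge; apply/negP => xle.
apply: xM => i /=; rewrite in_itv/= -ler_norml.
exact: le_trans (coord_le_enorm x i) xle.
Qed.

Lemma weight_bounded : exists2 B : R, 0 < B & forall x, phi x <= B.
Proof.
have [r rP] := weight_small ltr01.
have loc (x : E) : exists K : R, \forall y \near x, ((phi y)%:E <= K%:E)%E.
  exists (phi x + 1); have /cvgrPdist_lt/(_ 1 ltr01) := weight_continuous (x := x).
  apply: filterS => y; rewrite ltr_norml lee_fin => /andP[yx _]; lra.
have [K KP] := locally_bounded_compact (@box_compact _ N r) loc.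
exists (Num.max K 1) => [|x]; first by rewrite lt_max ltr01 orbT.
rewrite le_max; have [/KP|/rP/ltW ->] := pselect (box r x); last by rewrite orbT.
by rewrite lee_fin => ->.
Qed.

Lemma jump_integral_fin x : jump_integral s p phi x \is a fin_num.
Proof.
case: hphi => _ _ _ /(_ x)[K /nbhs_singleton KP] _.
rewrite ge0_fin_numE ?jump_integral_ge0//; rewrite MopE// in KP; last exact: weight_measurable.
by rewrite gee0_abs ?jump_integral_ge0// in KP; rewrite (le_lt_trans KP)// ltry.
Qed.

Lemma jump_integral_box_bounded r : exists2 K : R, 0 <= K &
  forall x, box r x -> (jump_integral s p phi x <= K%:E)%E.
Proof.
have loc (x : E) : exists K : R, \forall y \near x, (jump_integral s p phi y <= K%:E)%E.
  case: hphi => _ _ _ /(_ x)[K KP] _; exists K; apply: filterS KP => y.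
  by rewrite MopE//; [rewrite gee0_abs ?jump_integral_ge0//|exact: weight_measurable].
have [K KP] := locally_bounded_compact (@box_compact _ N r) loc.
exists (Num.max K 0) => [|x /KP xK]; first by rewrite le_max lexx orbT.
by apply: (le_trans xK); rewrite lee_fin le_max lexx.
Qed.

Lemma integral_box_lty (c r : R) : 0 <= c ->
  (\int[mu]_x (c * \1_(box r) x)%:E < +oo)%E.
Proof.
move=> c0; under eq_integral do rewrite EFinM.
have mb : measurable (box r : set E) by exact: measurable_box.
rewrite ge0_integralZl//; last by apply/measurable_EFinP; exact: measurable_indic.
by rewrite integral_indic// setIT lte_mul_pinfty// box_finite.
Qed.

Definition cutoff (c : R) (x : E) : R := Num.max (phi x - c) 0.

Lemma cutoff_ge0 c x : 0 <= cutoff c x.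
Proof. by rewrite le_max lexx orbT. Qed.

Lemma cutoff_le c x : 0 <= c -> cutoff c x <= phi x.
Proof.
by move=> c0; rewrite ge_max (ltW (weight_gt0 x)) gerBl c0.
Qed.

Lemma cutoff_contract c x y : `|cutoff c x - cutoff c y| <= `|phi x - phi y|.
Proof.
rewrite /cutoff.
have [a|a] := lerP (phi x - c) 0; have [b|b] := lerP (phi y - c) 0.
- by rewrite subrr normr0.
- by rewrite sub0r normrN gtr0_norm// distrC (le_trans _ (ler_norm _))//; lra.
- by rewrite subr0 gtr0_norm// (le_trans _ (ler_norm _))//; lra.
- by rewrite opprB addrA subrK.
Qed.

Lemma cutoff_measurable c : measurable_fun setT (cutoff c).
Proof.
apply: measurable_maxr; last exact: measurable_cst.
by apply: measurable_funB; [exact: weight_measurable|exact: measurable_cst].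
Qed.

Lemma cutoff_indic c : 0 < c -> exists r : R, forall x, cutoff c x != 0 -> x \in box r.
Proof.
move=> c0; have [r rP] := weight_small c0; exists r => x; apply: contraNT.
move=> /negP xb; rewrite /cutoff max_r// subr_le0 ltW// rP// => xb'.
by apply: xb; rewrite inE.
Qed.

Lemma cutoff_L2 c : 0 < c -> cutoff c \in L2.
Proof.
move=> c0; have [r rP] := cutoff_indic c0; have [B B0 BP] := weight_bounded.
apply: L2P; first exact: cutoff_measurable.
apply: (le_lt_trans _ (@integral_box_lty (B ^+ 2) r (sqr_ge0 _))).
apply: ge0_le_integral => //.
- by move=> x _; rewrite lee_fin sqr_ge0.
- by apply/measurable_EFinP; apply: measurable_funX; exact: cutoff_measurable.
- apply/measurable_EFinP; apply: measurable_funM; first exact: measurable_cst.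
  by apply: measurable_indic; exact: measurable_box.
move=> x _; rewrite lee_fin indicE; case: (boolP (x \in box r)) => [_|xb].
  rewrite mulr1 lerXn2r ?nnegrE ?cutoff_ge0 ?(ltW B0)//.
  by rewrite (le_trans _ (BP x))// cutoff_le// ltW.
by rewrite mulr0 (_ : cutoff c x = 0) ?expr0n//; apply/eqP; apply: contraNT xb; exact: rP.
Qed.

(** The jumps of the cutoff are bounded by B and by those of phi, and vanish
unless one of the two points is in the box that carries it.  So the double
integral is at most B^(p-1) times twice the integral of M phi over that box,
and M phi is bounded there. *)
Lemma cutoff_energy c : 0 < c -> (energy s p (cutoff c) < +oo)%E.
Proof.
move=> c0; have [r rP] := cutoff_indic c0; have [B B0 BP] := weight_bounded.
have [K K0 KP] := jump_integral_box_bounded r.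
pose a (x : E) := B `^ (p - 1) * \1_(box r) x.
have a0 x : 0 <= a x by rewrite mulr_ge0 ?powR_ge0.
have ma : measurable_fun setT a.
  apply: measurable_funM; first exact: measurable_cst.
  by apply: measurable_indic; exact: measurable_box.
have mj := measurable_jump_density s p weight_measurable.
have Gs x y : jump_density s p phi (x, y) = jump_density s p phi (y, x).
  by rewrite /jump_density kern_sym distrC.
have sym := integral_pair_sym mu ma a0 mj (@jump_density_ge0 _ _ _ _ phi) Gs.
have fin : (\int[mu]_x ((a x)%:E * jump_integral s p phi x) < +oo)%E.
  have BK : 0 <= B `^ (p - 1) * K by rewrite mulr_ge0 ?powR_ge0.
  apply: (le_lt_trans _ (@integral_box_lty _ r BK)).
  apply: ge0_le_integral => //.
  - by move=> x _; rewrite mule_ge0 ?jump_integral_ge0// lee_fin.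
  - apply: emeasurable_funM; first exact/measurable_EFinP.
    by apply: measurable_jump_integral; exact: weight_measurable.
  - apply/measurable_EFinP; apply: measurable_funM; first exact: measurable_cst.
    by apply: measurable_indic; exact: measurable_box.
  move=> x _; rewrite /a indicE; case: (boolP (x \in box r)) => [|_].
    by rewrite inE => /KP xK; rewrite !mulr1 EFinM lee_wpmul2l// lee_fin powR_ge0.
  by rewrite !mulr0 mul0e.
have le : (\int[mu \x mu]_z (`|cutoff c z.1 - cutoff c z.2| `^ p * kern s p z)%:E <=
    \int[mu \x mu]_z ((a z.1 + a z.2) * jump_density s p phi z)%:E)%E.
  apply: ge0_le_integral => //.
  - by move=> z _; rewrite lee_fin mulr_ge0 ?powR_ge0 ?kern_ge0.
  - by apply: measurable_pair_term; exact: cutoff_measurable.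
  - apply/measurable_EFinP; apply: measurable_funM => //.
    apply: measurable_funD; first exact: (measurableT_comp ma measurable_fst).
    exact: (measurableT_comp ma measurable_snd).
  move=> [x y] _ /=; rewrite lee_fin /jump_density /= mulrA.
  rewrite ler_wpM2r ?kern_ge0//.
  have [d0|dn0] := eqVneq (cutoff c x - cutoff c y) 0.
    by rewrite d0 normr0 powR0 ?gt_eqF// mulr_ge0// addr_ge0.
  have dB : `|cutoff c x - cutoff c y| <= B.
    have cB w : cutoff c w <= B by rewrite (le_trans _ (BP w))// cutoff_le// ltW.
    have := cB x; have := cB y; have := cutoff_ge0 c x; have := cutoff_ge0 c y.
    by rewrite ler_norml => ? ? ? ?; apply/andP; split; lra.
  rewrite -mulr_powRB1// mulrC; apply: ler_pM; [exact: powR_ge0|exact: normr_ge0| |].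
    apply: (@le_trans _ _ (B `^ (p - 1))).
      by rewrite ge0_ler_powR ?nnegrE ?(ltW p10) ?(ltW B0).
    rewrite /a -mulrDr -[leLHS]mulr1 ler_wpM2l ?powR_ge0// !indicE.
    have [x0|x0] := eqVneq (cutoff c x) 0; last by rewrite (rP _ x0) lerDl.
    have y0 : cutoff c y != 0 by move: dn0; rewrite x0 sub0r oppr_eq0.
    by rewrite (rP _ y0) lerDr.
  exact: cutoff_contract.
rewrite energyE; apply: lte_mul_pinfty => //.
- by rewrite lee_fin invr_ge0 mulr_ge0// ltW.
- apply: (le_lt_trans le); rewrite sym; apply: lte_mul_pinfty => //.
Qed.

(** Hoelder's inequality for |u|^(p-1) M phi = (|u| phi)^(p-1) (M phi / phi^(p-1))
with exponents 1/(p-1) and 1/(2-p). *)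
Lemma jump_pairing_le (u : E -> R) (X : R) : measurable_fun setT u ->
  (\int[mu]_x (`|u x| * phi x)%:E = X%:E)%E ->
  (jump_pairing s p u phi <= (X `^ (p - 1) * fine (Cphi s p phi) `^ (2 - p))%:E)%E.
Proof.
move=> m_u XE.
have mphi := weight_measurable.
pose m x := fine (jump_integral s p phi x).
have mE x : jump_integral s p phi x = (m x)%:E by rewrite /m fineK// jump_integral_fin.
have m0 x : 0 <= m x by rewrite fine_ge0// jump_integral_ge0.
have mm : measurable_fun setT m.
  apply/measurable_EFinP; rewrite (_ : _ \o _ = jump_integral s p phi).
    exact: measurable_jump_integral.
  by apply/funext => x; rewrite mE.
pose f x := (`|u x| * phi x) `^ (p - 1).
(* C(phi) is the integral of g^(1/(2-p)) *)
pose g x := m x * (phi x `^ (p - 1))^-1.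
have mf : measurable_fun setT f.
  apply: (@measurableT_comp _ _ _ _ _ _ (@powR R ^~ _)); first exact: measurable_powR.
  by apply: measurable_funM => //; apply: measurableT_comp.
have mg : measurable_fun setT g.
  apply: measurable_funM => //.
  rewrite [X in measurable_fun _ X](_ : _ = fun x => phi x `^ (- (p - 1))).
    by apply: (@measurableT_comp _ _ _ _ _ _ (@powR R ^~ _)); first exact: measurable_powR.
  by apply/funext => x; rewrite powRN.
have f0 x : 0 <= f x by exact: powR_ge0.
have g0 x : 0 <= g x by rewrite mulr_ge0// invr_ge0 powR_ge0.
have CE : Cphi s p phi = (\int[mu]_x (g x `^ (2 - p)^-1)%:E)%E.
  apply: eq_integral => x _; rewrite MopE// mE /=.
  rewrite ger0_norm// -EFinM /g powRM ?invr_ge0 ?powR_ge0//.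
  have -> : ((phi x `^ (p - 1))^-1) `^ (2 - p)^-1 = (phi x `^ ((p - 1) / (2 - p)))^-1.
    by rewrite -powRN -powRrM mulNr powRN.
  by [].
have Cfin : Cphi s p phi \is a fin_num.
  rewrite ge0_fin_numE; first by case: hphi.
  by rewrite CE; apply: integral_ge0 => x _; rewrite lee_fin powR_ge0.
have H := @hoelder _ _ _ mu f g (p - 1)^-1 (2 - p)^-1 mf mg.
rewrite !invr_gt0 !invrK in H; have {H} := H p10 p20 ltac:(ring).
have -> : 'N[mu]_1[EFin \o (f \* g)%R]%E = jump_pairing s p u phi.
  rewrite Lnorm1; apply: eq_integral => x _ /=.
  have ph : phi x `^ (p - 1) != 0 by rewrite gt_eqF// powR_gt0// weight_gt0.
  have fE : f x = `|u x| `^ (p - 1) * phi x `^ (p - 1).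
    by rewrite /f powRM// ltW// weight_gt0.
  rewrite (ger0_norm (mulr_ge0 (f0 x) (g0 x))) mE -EFinM fE /g; congr EFin.
  by field.
have -> : 'N[mu]_(p - 1)^-1%:E[EFin \o f]%E = (X `^ (p - 1))%:E.
  rewrite unlock /= invrK -poweR_EFin -XE; congr (_ `^ _)%E.
  apply: eq_integral => x _ /=; rewrite ger0_norm// /f -powRrM mulfV ?gt_eqF//.
  by rewrite powRr1// mulr_ge0// ltW// weight_gt0.
have -> : 'N[mu]_(2 - p)^-1%:E[EFin \o g]%E = (fine (Cphi s p phi) `^ (2 - p))%:E.
  rewrite unlock /= invrK -poweR_EFin fineK// CE; congr (_ `^ _)%E.
  by apply: eq_integral => x _ /=; rewrite ger0_norm.
by rewrite EFinM.
Qed.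

End weights.

(** * The weighted mass of a solution *)

Section weighted.
Context {R : realType} {N : nat}.
Local Notation E := 'rV[R]_N.
Local Notation mu := (@lebesgue_rV R N).
Local Notation L2 := (Lfun mu 2%:E).
Local Notation ip := (ip mu).
Variables (s p : R) (S : R -> (E -> R) -> E -> R) (phi : E -> R).
Hypotheses (hs : 0 < s < 1) (hp : 1 < p < 2) (hS : generated_semigroup s p S).
Hypothesis hphi : class_C s p phi.

Let p10 : 0 < p - 1. Proof. by case/andP: hp; rewrite subr_gt0. Qed.

Let D : R := fine (Cphi s p phi) `^ (2 - p).

Lemma energyN (psi : E -> R) : energy s p (fun x : E => - psi x)%R = energy s p psi.
Proof.
rewrite !energyE; congr (_ * _)%E; apply: eq_integral => z _.
by rewrite opprK addrC distrC.
Qed.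

Definition mass (u : E -> R) : R := fine (\int[mu]_x (`|u x| * phi x)%:E)%E.

Section one_solution.
Variable f : E -> R.
Hypotheses (f2 : f \in L2) (f1 : f \in Lfun mu 1).
Hypothesis f0 : {ae mu, forall x, 0 <= f x}.

Let mS t : 0 <= t -> measurable_fun setT (S t f).
Proof. by move=> t0; exact: (semigroup_measurable hS). Qed.

Let mw (u : E -> R) : measurable_fun setT u -> measurable_fun setT (fun x => (`|u x| * phi x)%:E).
Proof.
move=> m_u; apply/measurable_EFinP; apply: measurable_funM.
  by apply: measurableT_comp.
exact: (weight_measurable hphi).
Qed.

(** The weight is bounded and the L1 norm of the solution does not exceed that of
its initial datum. *)
Lemma mass_bound : exists B : R, forall t : R, 0 <= t ->
  (0 <= mass (S t f) <= B) /\
  (\int[mu]_x (`|S t f x| * phi x)%:E = (mass (S t f))%:E)%E.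
Proof.
have [B B0 BP] := weight_bounded hphi.
have f1fin : (\int[mu]_x `|f x|%:E)%E \is a fin_num.
  rewrite ge0_fin_numE ?integral_ge0//.
  by move/Lfun1_integrable/integrableP : f1 => [].
have f1ge0 : 0 <= fine (\int[mu]_x `|f x|%:E)%E by rewrite fine_ge0// integral_ge0.
exists (B * fine (\int[mu]_x `|f x|%:E)%E) => t t0.
have w0 x : (0 <= (`|S t f x| * phi x)%:E)%E.
  by rewrite lee_fin mulr_ge0// ltW// (weight_gt0 hphi).
have le : (\int[mu]_x (`|S t f x| * phi x)%:E <=
    (B * fine (\int[mu]_x `|f x|%:E)%E)%:E)%E.
  rewrite EFinM fineK//.
  apply: le_trans (_ : (\int[mu]_x (B%:E * `|S t f x|%:E) <= _)%E); last first.
    rewrite ge0_integralZl//; last by rewrite lee_fin ltW.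
      apply: lee_wpmul2l; first by rewrite lee_fin ltW.
      exact: (semigroup_L1_norm hp hS).
    by apply/measurable_EFinP; apply: measurableT_comp => //; exact: mS.
  apply: ge0_le_integral => //.
  - exact: (mw (mS t0)).
  - apply: measurable_funeM; apply/measurable_EFinP.
    by apply: measurableT_comp => //; exact: mS.
  - by move=> x _; rewrite -EFinM lee_fin mulrC ler_wpM2r.
have fin : (\int[mu]_x (`|S t f x| * phi x)%:E)%E \is a fin_num.
  by rewrite ge0_fin_numE ?integral_ge0// (le_lt_trans le)// ltry.
split; last by rewrite fineK.
rewrite fine_ge0 ?integral_ge0//= -lee_fin fineK//.
Qed.

(** The derivative of <psi, u(t)> is - <xi, psi>; weak_bound for - psi and the
Hoelder bound control it. *)
Lemma truncated_mass_growth (psi : E -> R) (a b M : R) : psi \in L2 ->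
  (energy s p psi < +oo)%E ->
  (forall x y, `|psi x - psi y| <= `|phi x - phi y|) ->
  0 <= a -> a <= b -> 0 <= M -> (forall t, a <= t <= b -> mass (S t f) <= M) ->
  ip psi (S b f) - ip psi (S a f) <= D * M `^ (p - 1) * (b - a).
Proof.
move=> psi2 Jpsi cpsi a0 ab M0 XM.
have [cu fu] := semigroup_flow hS f2.
have [u2 _] := cu.
apply: (@curve_growth _ _ _ mu (fun t => S t f) (fun=> psi)
  (fun t => ip psi (S t f)) _ _ _ cu a0 ab) => //.
- move=> g h g2 h2.
  have [] // := @L2_dom _ _ _ mu (fun x => g x - h x) (fun x => psi x - psi x) _ (L2B g2 h2).
    by apply: measurable_funB; exact: (L2_measurable psi2).
  by move=> x; rewrite subrr normr0.
- by move=> x y x0 y0; rewrite ipBr; auto.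
move=> t /andP[at_ tb].
have t0 : 0 < t := le_lt_trans a0 at_.
have [xi sxi rxi] := fu t t0; exists xi => //.
have x2 : xi \in L2 by case: sxi.
rewrite ipC -ipNr//.
have [B BP] := mass_bound; have [/andP[X0 _] XE] := BP t (ltW t0).
have W : ((ip xi (fun x => - psi x))%:E <= jump_pairing s p (S t f) phi)%E.
  apply: (weak_bound hp sxi); first exact: L2N.
  - exact: (weight_measurable hphi).
  - by rewrite energyN.
  - by move=> x y; rewrite opprK addrC distrC.
have := le_trans W (jump_pairing_le hs hp hphi (mS (ltW t0)) XE).
rewrite lee_fin mulrC => /le_trans; apply; rewrite ler_wpM2l ?powR_ge0//.
rewrite ge0_ler_powR ?nnegrE ?(ltW p10)//; apply: XM.
by rewrite !ltW.
Qed.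

Lemma truncated_mass_cvg t : 0 <= t ->
  ip (cutoff phi n.+1%:R^-1) (S t f) @[n --> \oo] --> mass (S t f).
Proof.
move=> t0; have [B BP] := mass_bound; have [_ XE] := BP t t0.
have S0 := semigroup_ge0 hp hS f2 t0 f0.
have n0 (n : nat) : 0 < n.+1%:R^-1 :> R by rewrite invr_gt0.
have c2 (n : nat) : cutoff phi n.+1%:R^-1 \in L2 by exact: (cutoff_L2 hphi).
have S2 : S t f \in L2 by have [H _ _ _] := hS f2; exact: H.
have int : mu.-integrable setT (fun x => (`|S t f x| * phi x)%:E).
  apply/integrableP; split; first exact: (mw (mS t0)).
  under eq_integral => x _ do rewrite gee0_abs ?lee_fin ?mulr_ge0 ?(ltW (weight_gt0 hphi _))//.
  by rewrite XE ltry.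
have mn (n : nat) : measurable_fun setT (fun x => (cutoff phi n.+1%:R^-1 x * S t f x)%:E).
  apply/measurable_EFinP; apply: measurable_funM; last exact: mS.
  exact: (cutoff_measurable hphi).
have cvx : {ae mu, forall x, setT x -> (cutoff phi n.+1%:R^-1 x * S t f x)%:E @[n --> \oo] -->
    (`|S t f x| * phi x)%:E}.
  apply: filterS S0 => x x0 _; rewrite ger0_norm// (mulrC (S t f x)).
  apply: cvg_EFin; first by near=> n.
  apply: cvgMl.
  apply: (@squeeze_cvgr _ _ _ _ (fun n : nat => phi x - n.+1%:R^-1) (fun=> phi x)).
  - near=> n; rewrite (cutoff_le hphi) ?(ltW (n0 _))// andbT.
    by rewrite /cutoff le_max lexx.
  - rewrite -[X in _ --> X]subr0; apply: cvgB; first exact: cvg_cst.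
    exact: cvg_harmonic.
  - exact: cvg_cst.
have dom : {ae mu, forall x n, setT x ->
    (`|(cutoff phi n.+1%:R^-1 x * S t f x)%:E| <= (`|S t f x| * phi x)%:E)%E}.
  apply: nearW => x n _; rewrite /= lee_fin normrM mulrC ler_wpM2l//.
  by rewrite ger0_norm ?cutoff_ge0// (cutoff_le hphi)// ltW.
have [_ _] := dominated_convergence measurableT mn (mw (mS t0)) cvx int dom.
rewrite XE => /fine_cvg; apply: cvg_trans; rewrite /ip /Rintegral.
by apply: near_eq_cvg; near=> n.
Unshelve. all: by end_near.
Qed.

(** The estimates for the cutoffs of phi at level 1/(n+1), and for their
opposites, hold with a right-hand side independent of n. *)
Lemma mass_growth (a b M : R) : 0 <= a -> a <= b -> 0 <= M ->
  (forall t, a <= t <= b -> mass (S t f) <= M) ->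
  `|mass (S b f) - mass (S a f)| <= D * M `^ (p - 1) * (b - a).
Proof.
move=> a0 ab M0 XM; have b0 := le_trans a0 ab.
have n0 (n : nat) : 0 < n.+1%:R^-1 :> R by rewrite invr_gt0.
have c2 (n : nat) : cutoff phi n.+1%:R^-1 \in L2 by exact: (cutoff_L2 hphi).
have S2 t : 0 <= t -> S t f \in L2 by have [H _ _ _] := hS f2; exact: H.
have cc (n : nat) x y : `|cutoff phi n.+1%:R^-1 x - cutoff phi n.+1%:R^-1 y| <= `|phi x - phi y|.
  exact: cutoff_contract.
have Jc (n : nat) : (energy s p (cutoff phi n.+1%:R^-1) < +oo)%E by exact: (cutoff_energy hs hp hphi).
have cvn : `|ip (cutoff phi n.+1%:R^-1) (S b f) - ip (cutoff phi n.+1%:R^-1) (S a f)|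
    @[n --> \oo] --> `|mass (S b f) - mass (S a f)|.
  by apply: cvg_norm; apply: cvgB; exact: truncated_mass_cvg.
rewrite -(cvg_lim _ cvn)//; apply: limr_le.
  by apply/cvg_ex; exists `|mass (S b f) - mass (S a f)|.
apply: nearW => n /=; rewrite ler_norml; apply/andP; split; last first.
  exact: truncated_mass_growth.
rewrite lerNl opprB.
have := @truncated_mass_growth (fun x => - cutoff phi n.+1%:R^-1 x) a b M (L2N (c2 n)).
rewrite energyN => H; have {}H := H (Jc n) _ a0 ab M0 XM.
have ipN w : w \in L2 -> ip (fun x => - cutoff phi n.+1%:R^-1 x) w =
    - ip (cutoff phi n.+1%:R^-1) w.
  by move=> w2; rewrite ipC ipNr// ipC.
move: H; rewrite !ipN ?opprK; auto.
rewrite addrC; apply => x y; rewrite opprK addrC distrC; exact: cc.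
Qed.

Lemma mass_powR_lipschitz (a b : R) : 0 <= a -> 0 <= b ->
  `|mass (S a f) `^ (2 - p) - mass (S b f) `^ (2 - p)| <= (2 - p) * D * `|a - b|.
Proof.
have [B BP] := mass_bound.
apply: (@powR_lipschitz_of_ode _ (fun t => mass (S t f)) p D B) => //.
- exact: powR_ge0.
- by move=> t /BP[].
- exact: mass_growth.
Qed.

End one_solution.

(** The approximate solutions increase to u, so u phi dominates. *)
Lemma minimal_mass_cvg u0 u : minimal_solution S u0 u -> exists2 fn,
  approx_from_below fn u0 & forall t : R, 0 <= t ->
    weighted_mass phi (u t) \is a fin_num ->
    mass (S t (fn n)) @[n --> \oo] --> fine (weighted_mass phi (u t)).
Proof.
move=> mi; have [fn af lu] := mi; exists fn => // t t0 Xfin.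
have [m_u cu] := lu t t0.
have f2 n : fn n \in L2 by exact: approx_L2 af.
have S0 : {ae mu, forall x, forall n, 0 <= S t (fn n) x}.
  apply: ae_foralln => n; apply: (semigroup_ge0 hp hS) => //.
  by have [H _ _] := af; have [] := H n.
have Sle : {ae mu, forall x, forall n, ((S t (fn n) x)%:E <= u t x)%E}.
  apply: filterS2 cu (solution_cvg_sup hp hS t0 af) => x xc xs n.
  rewrite -(cvg_lim _ xc)// (cvg_lim _ xs)//.
  by apply: ereal_sup_ubound; exists n.
have mphi := weight_measurable hphi.
have mg : measurable_fun setT (fun x => (u t x * (phi x)%:E)%E).
  by apply: emeasurable_funM => //; exact/measurable_EFinP.
have u0' : {ae mu, forall x, (0 <= u t x)%E}.
  by apply: filterS2 S0 Sle => x x0 xu; apply: le_trans (xu 0%N); rewrite lee_fin.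
have gE : (\int[mu]_x `|u t x * (phi x)%:E| = weighted_mass phi (u t))%E.
  apply: ae_eq_integral => //; first exact: measurableT_comp.
  by apply: filterS u0' => x x0 _; rewrite gee0_abs// mule_ge0// lee_fin ltW// (weight_gt0 hphi).
have ig : mu.-integrable setT (fun x => `|u t x * (phi x)%:E|%E).
  apply/integrableP; split; first exact: measurableT_comp.
  by under eq_integral do rewrite abse_id; rewrite gE ltey_eq Xfin.
have mn (n : nat) : measurable_fun setT (fun x => (`|S t (fn n) x| * phi x)%:E).
  apply/measurable_EFinP; apply: measurable_funM => //.
  by apply: measurableT_comp => //; exact: (semigroup_measurable hS (f2 n) t0).
have cvx : {ae mu, forall x, setT x -> (`|S t (fn n) x| * phi x)%:E @[n --> \oo] -->
    (u t x * (phi x)%:E)%E}.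
  apply: filterS2 S0 cu => x x0 xc _.
  under eq_fun do rewrite ger0_norm// EFinM.
  exact: cvgeZr.
have dom : {ae mu, forall x n, setT x ->
    (`|(`|S t (fn n) x| * phi x)%:E| <= `|u t x * (phi x)%:E|)%E}.
  apply: filterS2 S0 Sle => x x0 xu n _.
  have px := weight_gt0 hphi x.
  rewrite abseM gee0_abs ?lee_fin ?mulr_ge0 ?(ltW px)// EFinM.
  rewrite (gee0_abs (_ : 0 <= (phi x)%:E)%E) ?lee_fin ?(ltW px)//.
  rewrite lee_wpmul2r// ?lee_fin ?(ltW px)// ger0_norm//.
  by rewrite gee0_abs// (le_trans _ (xu 0%N))// lee_fin.
have [_ _] := dominated_convergence measurableT mn mg cvx ig dom.
rewrite -/(weighted_mass phi (u t)) -(fineK Xfin) => /fine_cvg.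
by [].
Qed.

Lemma minimal_weighted_estimate u0 u (t1 t2 : R) : minimal_solution S u0 u ->
  0 <= t1 -> 0 <= t2 ->
  weighted_mass phi (u t1) \is a fin_num -> weighted_mass phi (u t2) \is a fin_num ->
  `|fine (weighted_mass phi (u t1)) `^ (2 - p) -
    fine (weighted_mass phi (u t2)) `^ (2 - p)| <= (2 - p) * D * `|t1 - t2|.
Proof.
have q0 : 0 < 2 - p by case/andP: hp; rewrite subr_gt0.
have q1 : 2 - p <= 1 by move: p10; lra.
move=> /minimal_mass_cvg[fn af X] a0 b0 /(X _ a0) Xa /(X _ b0) Xb.
apply/ler_addgt0Pr => e e0.
have e2 : 0 < e / 2 by rewrite divr_gt0.
have r0 : 0 < (e / 2) `^ (2 - p)^-1 by rewrite powR_gt0.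
have mass_ge0 w : 0 <= mass w.
  rewrite fine_ge0// integral_ge0// => x _.
  by rewrite lee_fin mulr_ge0// ltW// (weight_gt0 hphi).
have lim_ge0 (v : nat -> R) (l : R) : (forall n, 0 <= v n) -> v n @[n --> \oo] --> l -> 0 <= l.
  move=> v0 vl; rewrite -(cvg_lim _ vl)//; apply: limr_ge; last exact: nearW.
  by apply/cvg_ex; exists l.
have Xa0 := lim_ge0 _ _ (fun n => mass_ge0 _) Xa.
have Xb0 := lim_ge0 _ _ (fun n => mass_ge0 _) Xb.
near \oo => n.
have A : `|fine (weighted_mass phi (u t1)) - mass (S t1 (fn n))| <= (e / 2) `^ (2 - p)^-1.
  by apply: ltW; near: n; move/cvgrPdist_lt : Xa; apply.
have B : `|fine (weighted_mass phi (u t2)) - mass (S t2 (fn n))| <= (e / 2) `^ (2 - p)^-1.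
  by apply: ltW; near: n; move/cvgrPdist_lt : Xb; apply.
have [fa _ _] := af; have [f1 foo f0] := fa n.
have L := mass_powR_lipschitz (L1_Loo_L2 f1 foo) f1 f0 a0 b0.
have tri (x y v w K : R) : `|x - v| <= e / 2 -> `|y - w| <= e / 2 ->
    `|v - w| <= K -> `|x - y| <= K + e.
  rewrite !ler_norml => /andP[? ?] /andP[? ?] /andP[? ?].
  by apply/andP; split; lra.
exact: tri (powR_close Xa0 (mass_ge0 _) e2 q0 q1 A)
  (powR_close Xb0 (mass_ge0 _) e2 q0 q1 B) L.
Unshelve. all: by end_near.
Qed.

End weighted.

(** * Uniqueness, comparison and the weighted estimate *)

Theorem theorem3p2 (R : realType) (N : nat) (s p : R)
  (S : R -> ('rV[R]_N -> R) -> 'rV[R]_N -> R)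
  (hN : (1 <= N)%N) (hs : 0 < s < 1) (hp : 1 < p < 2) (hsp : s * p < 1)
  (hS : generated_semigroup s p S) :
  [/\ (* the limit exists and does not depend on the approximation *)
      forall u0 : 'rV[R]_N -> R, initial_datum s p u0 ->
        exists2 u : R -> 'rV[R]_N -> \bar R, minimal_solution S u0 u &
          forall u0n, approx_from_below u0n u0 -> limit_of_solutions S u0n u,
      (* comparison *)
      forall (u0 v0 : 'rV[R]_N -> R) (u v : R -> 'rV[R]_N -> \bar R),
        initial_datum s p u0 -> initial_datum s p v0 ->
        {ae lebesgue_rV N, forall x, u0 x <= v0 x} ->
        minimal_solution S u0 u -> minimal_solution S v0 v ->
        forall t : R, 0 <= t -> {ae lebesgue_rV N, forall x, (u t x <= v t x)%E} &
      (* weighted L^1 estimate *)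
      forall (u0 : 'rV[R]_N -> R) (u : R -> 'rV[R]_N -> \bar R)
          (phi : 'rV[R]_N -> R),
        initial_datum s p u0 -> minimal_solution S u0 u -> class_C s p phi ->
        forall t1 t2 : R, 0 <= t1 -> 0 <= t2 ->
          let X t := weighted_mass phi (u t) in
          X t1 \is a fin_num -> X t2 \is a fin_num ->
          `|fine (X t1) `^ (2 - p) - fine (X t2) `^ (2 - p)| <=
            (2 - p) * fine (Cphi s p phi) `^ (2 - p) * `|t1 - t2|].
Proof.
split.
- move=> u0 [locu u0_ge0 _]; have af := truncation_approx locu u0_ge0.
  exists (sup_solution S (truncation u0)).
    by exists (truncation u0) => //; exact: (sup_solution_minimal hp hS af af).
  by move=> u0n au; exact: (sup_solution_minimal hp hS af au).
- move=> u0 v0 u v _ _ uv mu mv t t0.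
  exact: (minimal_solution_le hp hS mu mv uv t0).
- move=> u0 u phi _ mu cphi t1 t2 t10 t20 X X1 X2.
  exact: (minimal_weighted_estimate hs hp hS cphi mu t10 t20 X1 X2).
Qed.
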